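(* Fix any $\varepsilon>0$, and for each $n\ge 1$ choose $\pi^{(n)}$ uniformly at random from $S_n$. Then $d_{\square}\big(\gamma_{\mathsf{runsort}(\pi^{(n)})},\mathbf{R}\big)<\varepsilon$ with probability tending to $1$ as $n\to\infty$.
   Context: $S_n$ is the set of permutations $\pi=\pi_1\cdots\pi_n$ of $[n]=\{1,\dots,n\}$. An (ascending) run of $\pi$ is a maximal block of consecutive positions on which the entries are increasing. $\mathsf{runsort}(\pi)$ is the permutation obtained by reordering the runs of $\pi$ (each kept intact) so that their smallest (i.e. first) entries appear in increasing order; e.g. $\mathsf{runsort}(351476298)=147293568$. For $\pi\in S_n$, $\gamma_\pi$ is the probability measure on $[0,1]^2$ with density $n$ on each square $[(i-1)/n,i/n)\times[(\pi_i-1)/n,\pi_i/n)$, $i\in[n]$, and density $0$ elsewhere. For probability measures $\gamma_1,\gamma_2$ on $[0,1]^2$, $d_\square(\gamma_1,\gamma_2)=\sup_B|\gamma_1(B)-\gamma_2(B)|$, the supremum over axis-parallel rectangles $B\subseteq[0,1]^2$. Let $\mathcal C=\{(x,y)\in[0,1]^2: x=ye^{1-y}\}$ and $\mathcal C^+=\{(x,y)\in[0,1]^2: x<ye^{1-y}\}$. The runsort permuton $\mathbf R$ is the probability measure on $[0,1]^2$ given by $\mathbf R(B)=\int_{B\cap\mathcal C^+}e^{y-1}\,dx\,dy+\int_{B\cap\mathcal C}(1-y)\,dy$ for measurable $B$ (the second integral is with respect to the coordinate $y$ parametrizing the curve $\mathcal C$). *)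

(* Defs.v *)
From HB Require Import structures.
From mathcomp Require Import all_boot all_order all_fingroup all_algebra.
From mathcomp Require Import all_classical all_reals all_analysis.
From mathcomp Require Import measurable_realfun.

Set Implicit Arguments.
Unset Strict Implicit.
Unset Printing Implicit Defensive.

Import Order.TTheory GRing.Theory Num.Theory.
Import numFieldNormedType.Exports.

Local Open Scope classical_set_scope.
Local Open Scope ring_scope.

Section Runsort.
Local Open Scope nat_scope.

Fixpoint runs (s : seq nat) : seq (seq nat) :=
  if s is x :: s' then
    match runs s' with
    | (y :: r) :: rs =>
        if x < y then (x :: y :: r) :: rs else [:: x] :: (y :: r) :: rs
    | rs => [:: x] :: rs
    end
  else [::].

Definition runsort_word (s : seq nat) : seq nat :=
  flatten (sort (fun r1 r2 => head 0 r1 <= head 0 r2) (runs s)).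

Example runs_example :
  runs [:: 3; 5; 1; 4; 7; 6; 2; 9; 8]
  = [:: [:: 3; 5]; [:: 1; 4; 7]; [:: 6]; [:: 2; 9]; [:: 8]].
Proof. by []. Qed.

Example runsort_word_example :
  runsort_word [:: 3; 5; 1; 4; 7; 6; 2; 9; 8]
  = [:: 1; 4; 7; 2; 9; 3; 5; 6; 8].
Proof. by []. Qed.

Lemma flatten_runs (s : seq nat) : flatten (runs s) = s.
Proof.
elim: s => //= x s; case: (runs s) => [|[|y r] rs] /= IH; rewrite -?IH //.
by case: ifP.
Qed.

Lemma perm_runsort_word (s : seq nat) : perm_eq (runsort_word s) s.
Proof.
rewrite -[X in perm_eq _ X]flatten_runs.
by apply: perm_flatten; rewrite perm_sort.
Qed.

Definition one_line n (p : 'S_n) : seq nat := [seq val (p i) | i <- enum 'I_n].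

Lemma perm_one_line n (p : 'S_n) : perm_eq (one_line p) (iota 0 n).
Proof.
apply: uniq_perm; rewrite ?iota_uniq //.
  by rewrite map_inj_uniq ?enum_uniq // => i j /val_inj/perm_inj.
move=> k; rewrite mem_iota add0n leq0n andTb; apply/mapP/idP => [[i _ ->]|kn].
  exact: ltn_ord.
by exists ((p^-1)%g (Ordinal kn)); rewrite ?mem_enum // permKV.
Qed.

Lemma perm_runsort_iota n (p : 'S_n) :
  perm_eq (runsort_word (one_line p)) (iota 0 n).
Proof. exact: perm_trans (perm_runsort_word _) (perm_one_line p). Qed.

(* The default values of [insubd] and [nth] are never used: see [runsortE]. *)
Definition runsort_fun n (p : 'S_n) (i : 'I_n) : 'I_n :=
  insubd i (nth 0 (runsort_word (one_line p)) i).

Lemma val_runsort_fun n (p : 'S_n) (i : 'I_n) :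
  val (runsort_fun p i) = nth 0 (runsort_word (one_line p)) i.
Proof.
have pw := perm_runsort_iota p.
have iw : i < size (runsort_word (one_line p)).
  by rewrite (perm_size pw) size_iota.
rewrite val_insubd.
by have := mem_nth 0 iw; rewrite (perm_mem pw) mem_iota /= add0n => ->.
Qed.

Lemma runsort_fun_inj n (p : 'S_n) : injective (runsort_fun p).
Proof.
move=> i j /(congr1 val); rewrite !val_runsort_fun => /eqP.
have pw := perm_runsort_iota p.
rewrite nth_uniq ?(perm_uniq pw) ?iota_uniq ?(perm_size pw) ?size_iota //.
by move=> /eqP/val_inj.
Qed.

Definition runsort n (p : 'S_n) : 'S_n := perm (@runsort_fun_inj n p).

Lemma runsortE n (p : 'S_n) : one_line (runsort p) = runsort_word (one_line p).
Proof.
have sz : size (runsort_word (one_line p)) = n.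
  by rewrite (perm_size (perm_runsort_iota p)) size_iota.
apply: (@eq_from_nth _ 0); rewrite size_map size_enum_ord ?sz // => k kn.
rewrite (nth_map (Ordinal kn)) ?size_enum_ord // permE val_runsort_fun.
by rewrite nth_enum_ord.
Qed.

End Runsort.

Section Permutons.
Context {R : realType}.

Local Notation mu := (@lebesgue_measure R).
Local Notation mu2 := (mu \x mu)%E.

(* Probability measures on [0,1]^2 are represented as Borel measures on the
   plane that are concentrated on [unit_square]. *)
Definition unit_square : set (R * R) := `[0, 1] `*` `[0, 1].

(* Positions and values are numbered from 0, whence the absence of the usual
   shift by 1. *)
Definition perm_square n (p : 'S_n) (i : 'I_n) : set (R * R) :=
  `[i%:R / n%:R, i.+1%:R / n%:R[ `*` `[(p i)%:R / n%:R, (p i).+1%:R / n%:R[.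

Definition perm_density n (p : 'S_n) (z : R * R) : R :=
  n%:R * \1_(\bigcup_i perm_square p i) z.

Definition perm_permuton n (p : 'S_n) (B : set (R * R)) : \bar R :=
  (\int[mu2]_(z in B) (perm_density p z)%:E)%E.

Section perm_permuton_measure.
Variables (n : nat) (p : 'S_n).

Lemma measurable_perm_square (i : 'I_n) : measurable (perm_square p i).
Proof. exact: measurableX. Qed.

Lemma measurable_perm_density : measurable_fun setT (perm_density p).
Proof.
apply: measurable_funM => //; apply: measurable_indic.
by apply: fin_bigcup_measurable => // i _; exact: measurable_perm_square.
Qed.

Lemma perm_density_ge0 z : 0 <= perm_density p z.
Proof. by rewrite mulr_ge0. Qed.

Let perm_permuton0 : perm_permuton p set0 = 0%E.
Proof. by rewrite /perm_permuton integral_set0. Qed.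

Let perm_permuton_ge0 B : (0 <= perm_permuton p B)%E.
Proof. by apply: integral_ge0 => z _; rewrite lee_fin perm_density_ge0. Qed.

Let perm_permuton_sigma_additive : semi_sigma_additive (perm_permuton p).
Proof.
rewrite /perm_permuton.
apply: (semi_sigma_additive_nng_induced (mu := mu2)) => [|z].
  by apply/measurable_EFinP; exact: measurable_perm_density.
by rewrite lee_fin perm_density_ge0.
Qed.

HB.instance Definition _ := isMeasure.Build _ _ _ (perm_permuton p)
  perm_permuton0 perm_permuton_ge0 perm_permuton_sigma_additive.

Lemma perm_permuton_setT : (0 < n)%N -> perm_permuton p setT = 1%E.
Proof.
move=> n0; have n0R : 0 < n%:R :> R by rewrite ltr0n.
have cell_mu (k : nat) : mu `[k%:R / n%:R, k.+1%:R / n%:R[ = (n%:R^-1)%:E.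
  rewrite lebesgue_measure_itv /= lte_fin ltr_pM2r ?invr_gt0// ltr_nat ltnSn.
  by rewrite -EFinD -mulrBl -natrB// subSnn mul1r.
have cell_disj (i j : nat) (x : R) : x \in `[i%:R / n%:R, i.+1%:R / n%:R[ ->
    x \in `[j%:R / n%:R, j.+1%:R / n%:R[ -> (i <= j)%N.
  rewrite !in_itv /= => /andP[ix _] /andP[_ xj].
  have := le_lt_trans ix xj.
  by rewrite ltr_pM2r ?invr_gt0// ltr_nat ltnS.
rewrite /perm_permuton /perm_density.
under eq_integral do rewrite EFinM.
have mU : measurable (\bigcup_i perm_square p i).
  by apply: fin_bigcup_measurable => // i _; exact: measurable_perm_square.
rewrite ge0_integralZl//; last exact/measurable_EFinP/measurable_indic.
rewrite integral_indic// setIT measure_fin_bigcup//; first last.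
- by move=> i _; exact: measurable_perm_square.
- move=> i j _ _ [[x y] [[/= xi _] [/= xj _]]]; apply/val_inj/eqP.
  by rewrite eqn_leq (cell_disj _ _ _ xi xj) (cell_disj _ _ _ xj xi).
- exact: finite_finset.
rewrite (_ : [set: 'I_n] = [set` enum 'I_n]); last first.
  by apply/seteqP; split => i //= _; rewrite mem_enum.
rewrite -fsbig_seq ?enum_uniq//= (eq_bigr (fun=> (n%:R^-1 * n%:R^-1)%:E)).
  rewrite sumEFin big_const_seq count_predT size_enum_ord iter_addr_0 -EFinM.
  by rewrite -[_ *+ n in X in _ * X]mulr_natl !mulrA mulfK ?gt_eqF// divff ?gt_eqF.
by move=> i _; rewrite product_measure1E//= !cell_mu.
Qed.

End perm_permuton_measure.

Definition curve (y : R) : R * R := (y * expR (1 - y), y).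

Definition curveC : set (R * R) :=
  unit_square `&` [set z | z.1 = z.2 * expR (1 - z.2)].

Definition curveC_plus : set (R * R) :=
  unit_square `&` [set z | z.1 < z.2 * expR (1 - z.2)].

(* [curve] maps [0, 1] bijectively onto [curveC] (see [curve_curveC]), so that
   the second summand is the integral over B `&` curveC with respect to y. *)
Definition runsort_permuton (B : set (R * R)) : \bar R :=
  (\int[mu2]_(z in B `&` curveC_plus) (expR (z.2 - 1))%:E
   + \int[mu]_(y in [set y : R | (B `&` curveC) (curve y)])
       (1 - y)%:E)%E.

Section runsort_permuton_measure.

Let h (y : R) := y * expR (1 - y).

Let mh : measurable_fun setT h.
Proof.
apply: measurable_funM => //; apply: measurableT_comp => //.
exact: measurable_funB.
Qed.

Lemma measurable_unit_square : measurable unit_square.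
Proof. exact: measurableX. Qed.

Lemma measurable_curveC : measurable curveC.
Proof.
apply: measurableI; first exact: measurable_unit_square.
rewrite (_ : mkset _ = (fun z : R * R => z.1 == h z.2) @^-1` [set true]).
  rewrite -[X in measurable X]setTI; apply: measurable_fun_eqr => //.
  exact: measurableT_comp.
by apply/seteqP; split => z /= /eqP.
Qed.

Lemma measurable_curveC_plus : measurable curveC_plus.
Proof.
apply: measurableI; first exact: measurable_unit_square.
rewrite (_ : mkset _ = (fun z : R * R => z.1 < h z.2) @^-1` [set true]) //.
rewrite -[X in measurable X]setTI; apply: measurable_fun_ltr => //.
exact: measurableT_comp.
Qed.

Lemma measurable_curve : measurable_fun setT curve.
Proof. exact: measurable_fun_pair. Qed.

Let f1 := (fun z : R * R => (expR (z.2 - 1))%:E) \_ curveC_plus.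
Let f2 := (fun y : R => (1 - y)%:E) \_ (curve @^-1` curveC).

Let mf1 : measurable_fun setT f1.
Proof.
apply/(measurable_restrictT _ measurable_curveC_plus).
apply/measurable_EFinP/measurable_funTS/measurableT_comp => //.
exact: measurable_funB.
Qed.

Let mf2 : measurable_fun setT f2.
Proof.
have mD : measurable (curve @^-1` curveC).
  rewrite -[X in measurable X]setTI.
  by apply: measurable_curve => //; exact: measurable_curveC.
apply/(measurable_restrictT _ mD).
apply/measurable_EFinP/measurable_funTS.
exact: measurable_funB.
Qed.

Let f1_ge0 z : (0 <= f1 z)%E.
Proof. by rewrite /f1 patchE; case: ifP => // _; rewrite lee_fin expR_ge0. Qed.

Let f2_ge0 y : (0 <= f2 y)%E.
Proof.
rewrite /f2 patchE; case: ifPn => //; rewrite inE => -[[_ /=]] + _.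
by rewrite in_itv /= => /andP[_ y1]; rewrite lee_fin subr_ge0.
Qed.

Let runsort_permutonE B : runsort_permuton B =
  (\int[mu2]_(z in B) f1 z + \int[mu]_(y in curve @^-1` B) f2 y)%E.
Proof. by rewrite /f1 /f2 -!integral_mkcondr. Qed.

Let runsort_permuton0 : runsort_permuton set0 = 0%E.
Proof.
by rewrite runsort_permutonE preimage_set0 !integral_set0 adde0.
Qed.

Let runsort_permuton_ge0 B : (0 <= runsort_permuton B)%E.
Proof. by rewrite runsort_permutonE adde_ge0 ?integral_ge0. Qed.

Let runsort_permuton_sigma_additive : semi_sigma_additive runsort_permuton.
Proof.
move=> F mF tF mUF.
under eq_fun do
  (under eq_bigr do rewrite runsort_permutonE; rewrite big_split/=).
rewrite runsort_permutonE; apply: cvgeD.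
- by rewrite ge0_adde_def// inE integral_ge0.
- by apply: (semi_sigma_additive_nng_induced (mu := mu2) mf1 f1_ge0).
- have mpre k : measurable (curve @^-1` F k).
    by rewrite -[X in measurable X]setTI; exact: measurable_curve.
  rewrite preimage_bigcup.
  apply: (semi_sigma_additive_nng_induced (mu := mu) mf2 f2_ge0) => //.
    apply/trivIsetP => i j _ _ ij; rewrite -preimage_setI.
    by move/trivIsetP : tF => ->//; rewrite preimage_set0.
  exact: bigcupT_measurable.
Qed.

HB.instance Definition _ := isMeasure.Build _ _ _ runsort_permuton
  runsort_permuton0 runsort_permuton_ge0 runsort_permuton_sigma_additive.

Let le_h (y : R) : 0 <= y -> 0 <= h y <= 1.
Proof.
move=> y0; rewrite /h mulr_ge0 ?expR_ge0//= -(opprB y 1) expRN.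
rewrite ler_pdivrMr ?expR_gt0// mul1r.
by apply: le_trans (expR_ge1Dx _); rewrite addrC subrK.
Qed.

Lemma curve_curveC (y : R) : curveC (curve y) <-> y \in `[0, 1].
Proof.
split => [[[_ ]]//|]; rewrite in_itv /= => /andP[y0 y1].
split=> //; split; rewrite /= in_itv /=; last by rewrite y0.
exact: le_h.
Qed.

Let inner (y : R) :
  (\int[mu]_x f1 (x, y) = ((fun y => y%:E) \_ `[0%R, 1%R]) y)%E.
Proof.
rewrite patchE; case: ifPn => [|y01]; last first.
  apply: integral0_eq => x _; rewrite /f1 patchE; case: ifPn => //.
  by rewrite inE => -[[_ yy] _]; move: y01; rewrite notin_setE.
rewrite inE /= in_itv /= => /andP[y0 y1].
rewrite (_ : (fun x => f1 (x, y)) =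
  (cst (expR (y - 1))%:E) \_ `[0%R, h y[); last first.
  apply/funext => x; rewrite /f1 !patchE.
  congr (if _ then _ else _); apply/idP/idP; rewrite !inE /= !in_itv /=.
    by move=> [[/= + _] /= xh]; rewrite in_itv /= xh => /andP[-> _].
  move=> /andP[x0 xh]; split; [split|] => //=; rewrite in_itv/= ?y0// x0 /=.
  by have /andP[_ h1] := le_h y0; exact: le_trans (ltW xh) h1.
rewrite -integral_mkcond integral_cst//= lebesgue_measure_itv /= lte_fin.
have /andP[h0 _] := le_h y0.
have -> : (if (0 < h y)%R then (h y)%:E - 0 else 0)%E = (h y)%:E.
  case: ifPn; first by rewrite sube0.
  by rewrite -leNgt => hle0; congr EFin; apply/eqP; rewrite eq_le h0.
rewrite -EFinM /h mulrCA -expRD.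
by rewrite addrA subrK subrr expR0 mulr1.
Qed.

Let runsort_permuton_setT : runsort_permuton setT = 1%E.
Proof.
rewrite runsort_permutonE preimage_setT fubini_tonelli2//.
under eq_integral do rewrite /fubini_G inner.
rewrite -ge0_integralD//; last 2 first.
- by move=> y _; rewrite patchE; case: ifPn => //; rewrite inE/= in_itv/= => /andP[].
- apply/(measurable_restrictT _ (measurable_itv _)).
  by apply: measurable_funTS; exact: EFin_measurable.
transitivity (\int[mu]_(y in `[0%R, 1%R]) (cst 1) y)%E.
  rewrite [RHS]integral_mkcond; apply: eq_integral => y _.
  rewrite /f2 !patchE /=.
  have -> : (y \in curve @^-1` curveC) = (y \in `[0%R, 1%R]).
    by apply/idP/idP => [/set_mem /curve_curveC //|/curve_curveC /mem_set].
  rewrite mem_setE; case: ifP => // _; last by rewrite adde0.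
  by rewrite -EFinD addrC subrK.
by rewrite integral_cst//= mul1e lebesgue_measure_itv /= lte_fin ltr01 sube0.
Qed.

HB.instance Definition _ := @Measure_isProbability.Build _ _ R
  runsort_permuton runsort_permuton_setT.

End runsort_permuton_measure.

(* Each side may be any interval: open, closed, half-open, degenerate. *)
Definition rectangles : set (set (R * R)) :=
  [set B | B `<=` unit_square /\
     exists I J : interval R, B = [set` I] `*` [set` J]].

Definition d_box (g1 g2 : {measure set (R * R) -> \bar R}) : \bar R :=
  ereal_sup [set `|g1 B - g2 B|%E | B in rectangles].

End Permutons.

(* Probability that a uniformly random element of [T] lies in [A]. *)
Definition uniform_pr (R : realType) (T : finType) (A : {set T}) : R :=
  #|A|%:R / #|T|%:R.

(* Main.v *)
Require Import Defs.
From mathcomp Require Import all_boot all_order all_fingroup all_algebra.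
From mathcomp Require Import all_classical all_reals all_analysis.
From mathcomp Require Import measurable_realfun primitive_action alt.
From mathcomp Require Import zify ring lra.

Set Implicit Arguments.
Unset Strict Implicit.
Unset Printing Implicit Defensive.

Import Order.TTheory GRing.Theory Num.Theory.
Import numFieldNormedType.Exports.

Local Open Scope classical_set_scope.
Local Open Scope ring_scope.

(* For [0 <= A <= n] the entries whose run starts below [A] are exactly the first
   ones of the runsorted word, so its empirical distribution function is known
   once one counts, for all [A] and [B], the entries smaller than [B] whose run
   starts below [A].  Such an entry is preceded, within its run, by a last entry
   smaller than [A]; for [A <= B], sorting by the distance [k] between the two,
   the count is a sum over [k] of numbers of windows
     w_i < A <= w_(i+1) < ... < w_(i+k) < B.
   With A ~ a n and B ~ b n a second moment computation shows that the k-th of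
   these numbers is close to n a (b - a)^k / k!, and that few windows of length
   [K + 1] are increasing; so the count is close to n a e^(b - a), and for
   [b = 1] the position at which it is attained is close to n a e^(1 - a).
   This agrees with the distribution function min (x e^(y - 1), y) of the
   runsort permuton at x = a e^(1 - a) and y = b. *)

(** * Combinatorics of words: runs, early entries and increasing windows *)

Section Words.
Local Open Scope nat_scope.

Definition early (A : nat) (s : seq nat) : seq nat :=
  flatten [seq r <- runs s | head 0 r < A].

(** Replaces the nested match of [runs] in inductions on the word: a new first letter either extends
    the first run or opens a run of its own. *)
Lemma runs_cons x s : exists r rs,
  [/\ runs (x :: s) = (x :: r) :: rs, path ltn x r &
      runs s = if s is y :: s' then
                 if x < y then r :: rs else rs
               else rs].
Proof.
elim: s x => [|y s IH] x /=; first by exists [::], [::].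
have [r [rs [/= -> pr _]]] := IH y.
case: ifP => xy; last by exists [::], ((y :: r) :: rs).
by exists (y :: r), rs; rewrite /= xy.
Qed.

(** Once the blocks are sorted by their heads, those with a head below [A] come first, and
    flattening turns initial blocks into a prefix. *)
Lemma flatten_filter_sorted A (ss : seq (seq nat)) :
  sorted (fun r1 r2 => head 0 r1 <= head 0 r2) ss ->
  flatten [seq r <- ss | head 0 r < A]
  = take (size (flatten [seq r <- ss | head 0 r < A])) (flatten ss).
Proof.
elim: ss => [|r ss IH] //= pss.
have sss := path_sorted pss.
case: ifP => rA /=.
  by rewrite size_cat take_cat ltnNge leq_addr /= addKn -IH.
rewrite (@eq_in_filter _ _ pred0) ?filter_pred0 ?take0 // => t tss.
have tr : transitive (fun r1 r2 => head 0 r1 <= head 0 r2).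
  by move=> r1 r2 r3; exact: leq_trans.
by move: (order_path_min tr pss) => /allP/(_ t tss) /= rt; apply/negbTE; move/negbT: rA; rewrite -!leqNgt => /leq_trans; exact.
Qed.

(** Sorting only moves the early runs to the front, so a prefix of the runsorted word is known up to
    order. The length of this prefix depends on the word. *)
Lemma perm_early A s :
  perm_eq (take (size (early A s)) (runsort_word s)) (early A s).
Proof.
pose leh := fun r1 r2 => head 0 r1 <= head 0 r2.
have p : perm_eq (flatten [seq r <- sort leh (runs s) | head 0 r < A]) (early A s).
  by apply: perm_flatten; apply: perm_filter; rewrite perm_sort.
apply: (perm_trans _ p); rewrite -(perm_size p) /runsort_word -/leh.
rewrite -flatten_filter_sorted //; apply: sort_sorted => r1 r2; exact: leq_total.
Qed.

(* [chain A B k p s]: the word [p :: s] starts with an increasing window of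
   length [k + 1] whose entries after [p] are at least [A] and whose last entry
   is smaller than [B]. *)
Fixpoint chain (A B k p : nat) (s : seq nat) : bool :=
  if k is k'.+1 then
    if s is v :: s' then [&& A <= v, p < v & chain A B k' v s'] else false
  else p < B.

Definition chain_at A B k (s : seq nat) : bool :=
  if s is x :: s' then (x < A) && chain A B k x s' else false.

Definition incr_at k (s : seq nat) : bool :=
  (k < size s) && sorted ltn (take k.+1 s).

(** Positions are encoded by the suffixes that start there, so that counting windows recurses along
    the word; the empty suffix is not tested. *)
Fixpoint suffix_count (P : pred (seq nat)) (s : seq nat) : nat :=
  if s is x :: s' then P s + suffix_count P s' else 0.

Lemma suffix_countE P s : suffix_count P s = \sum_(i < size s) P (drop i s).
Proof.
by elim: s => [|x s IH]; rewrite ?big_ord0 // big_ord_recl /= IH.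
Qed.

(** A chain from [v] stays inside the first run, and its last letter is the entry it counts. Since
    [A <= v], the lower bound [A] holds automatically along the run. [M] only has to exceed every
    distance that can occur. *)
Lemma count_run A B v s r rs M : A <= v -> size s < M ->
  runs (v :: s) = (v :: r) :: rs ->
  \sum_(k < M) chain A B k v s = count (fun u => u < B) (v :: r).
Proof.
elim: s v r rs M => [|u s IH] v r rs [|M] // Av sM.
  move=> /= [<- _]; rewrite big_ord_recl /= big1 //.
have [r' [rs' [E _ _]]] := runs_cons u s.
rewrite [runs _]/= -/(runs (u :: s)) E big_ord_recl.
case: ifP => vu [<- _] /=; last by rewrite big1 // => i _; rewrite vu andbF.
congr (_ + _); rewrite -[RHS](IH u r' rs' M (leq_trans Av (ltnW vu)) sM E).
by apply: eq_bigr => k _; rewrite (leq_trans Av (ltnW vu)) vu.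
Qed.

(** Induction on the word. A first letter [x] with [A <= x] starts no chain, and neither its run nor
    what follows [x] in that run is early. If [x < A], it contributes itself and, when the next
    letter [y] satisfies [x < y] and [A <= y], the run of [y], which becomes early only through
    [x]. *)
Lemma early_count A B M s : size s <= M ->
  count (fun u => u < B) (early A s)
  = \sum_(k < M) suffix_count (chain_at A B k) s.
Proof.
elim: s => [|x s IH] sM; first by rewrite big1.
rewrite /= big_split /= -IH ?(ltnW sM) //.
have [r [rs [E pr Es]]] := runs_cons x s.
have -> : \sum_(i < M) ((x < A) && chain A B i x s) = (x < A) * \sum_(i < M) chain A B i x s.
  by rewrite big_distrr; apply: eq_bigr => k _; case: (x < A); rewrite /= ?mul1n ?mul0n.
rewrite /early Es E /=; case: s sM {IH} E Es => [|y s] sM E Es.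
  case: M sM => // M _; move: E => /= [<- <-].
  by rewrite big_ord_recl /= big1 //; case: ifP; rewrite /= ?addn0 ?mul1n ?mul0n.
case: ltnP => xA /=; last first.
  rewrite mul0n add0n; case: ifP => // xy.
  move: Es; rewrite xy; have [r' [rs' [/= -> _ _]]] := runs_cons y s.
  by move=> [<- _] /=; rewrite ltnNge (leq_trans xA (ltnW xy)).
case: M sM => // M sM; rewrite big_ord_recl mul1n count_cat -!addnA; congr (_ + _).
case: ltnP => xy; last first.
  have -> : r = [::].
    move: E; rewrite /=; case: (runs_cons y s) => [r' [rs' [/= -> _ _]]].
    by rewrite ltnNge xy => -[<-].
  by rewrite big1 // => i _ /=; rewrite ltnNge xy andbF.
move: Es; rewrite xy; have [r' [rs' [E' _ _]]] := runs_cons y s.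
rewrite E' => -[<- <-] /=; rewrite xy.
case: (ltnP y A) => yA /=.
  by rewrite big1 ?count_cat ?add0n ?addnA // => i _ /=; rewrite leqNgt yA.
by congr (_ + _); have /= <- := count_run B yA sM E'.
Qed.

Lemma chain_at_take A B k s :
  chain_at A B k s = (k < size s) && chain_at A B k (take k.+1 s).
Proof.
case: s => [|x s]; rewrite //= ltnS andbCA; congr (_ && _).
elim: k x s => [|k IH] x [|v s] //=.
by rewrite ltnS IH; case: (k <= size s); rewrite ?andbF.
Qed.

Lemma chain_path A B k v s : chain A B k v s -> incr_at k (v :: s).
Proof.
rewrite /incr_at /= ltnS.
elim: k v s => [|k IH] v [|u s] //= /and3P[_ vu /IH /andP[ks p]].
by rewrite ltnS ks vu.
Qed.

(* Each chain of length at least [K] is charged to the increasing window of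
   length [K + 1] that ends with it. *)
Lemma suffix_count_tail A B K M s :
  \sum_(K <= k < M) suffix_count (chain_at A B k) s
    <= suffix_count (incr_at K) s.
Proof.
have big_if (b : bool) (F : nat -> bool) m n :
    \sum_(m <= k < n) (b && F k : nat) = (if b then \sum_(m <= k < n) F k else 0).
  by case: b => //; rewrite big1.
(* The induction also carries the chains that continue from the current letter [v], without the
   condition [v < A]; this lets the charge pass from [v] to the next letter. *)
suff H v t : \sum_(K <= k < M) chain A B k v t
    + \sum_(K <= k < M) suffix_count (chain_at A B k) t
    <= suffix_count (incr_at K) (v :: t).
  case: s => [|v t]; first by rewrite big1.
  rewrite [X in X <= _]big_split; apply: leq_trans (H v t).
  by rewrite leq_add2r /= big_if; case: ifP.
elim: t v => [|u t IH] v.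
  rewrite [X in _ + X]big1 // addn0 /= addn0.
  have [KM|MK] := ltnP K M; last by rewrite big_geq.
  rewrite big_ltn // [X in _ + X]big_nat big1 ?addn0 => [|[|k] /andP[]] //.
  by case E: (chain _ _ _ _ _) => //; rewrite (chain_path E).
(* A chain from [v] with [k = K] is paid by the window at [v]; a longer one is, after removal of
   [v], a chain from [u]. *)
have step : \sum_(K <= k < M) chain A B k v (u :: t) <= incr_at K (v :: u :: t) +
   (if A <= u then \sum_(K <= k < M) chain A B k u t else 0).
  have [KM|MK] := ltnP K M; last by rewrite big_geq.
  rewrite big_ltn //; apply: leq_add.
    by case E: (chain _ _ _ _ _) => //; rewrite (chain_path E).
  case: M KM {IH} => // M KM.
  rewrite big_add1 /= big_if; case: ifP => // _; rewrite big_if; case: ifP => // _.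
  by rewrite big_nat_recr //= leq_addr.
rewrite [X in _ <= X]/=; apply: leq_trans (leq_add step (leqnn _)) _.
rewrite -addnA leq_add2l; apply: leq_trans (IH u).
case: (leqP A u) => Au.
  rewrite leq_add2l; apply: leq_sum => k _ /=.
  by rewrite ltnNge Au.
rewrite add0n [X in X <= _]big_split /= big_if.
by rewrite Au.
Qed.

End Words.

(** * First and second moments of window counts over the symmetric group *)

Section PermutationCounting.
Local Open Scope nat_scope.
Variable n : nat.

(** This is the [r]-fold transitivity of the symmetric group. *)
Lemma uniq_tuple_extension r (t u : r.-tuple 'I_n) : uniq t -> uniq u ->
  exists s : 'S_n, map_tuple s t = u.
Proof.
move=> ut uu; have rn : r <= #|'I_n|.
  by rewrite -(size_tuple t) -(card_uniqP ut) max_card.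
have tr := ntransitive_weak rn (Sym_trans 'I_n).
have inD (v : r.-tuple 'I_n) : uniq v -> v \in dtuple_on r [set: 'I_n]%SET.
  by move=> uv; rewrite inE uv; apply/fintype.subsetP => x; rewrite inE.
have [g _ ->] := atransP2 tr (inD t ut) (inD u uu).
by exists g; apply: val_inj.
Qed.

(** Multiplication by a permutation carrying [v] to [v'] embeds the fibre over [v] into the fibre
    over [v'], so all fibres over injective tuples have the same size. There are [n ^_ r] of them
    and they partition ['S_n]; the product form avoids division. *)
Lemma card_perm_map r (t u : r.-tuple 'I_n) : uniq t -> uniq u ->
  #|[set s : 'S_n | map_tuple s t == u]%SET| * n ^_ r = n`!.
Proof.
move=> ut uu; pose c (v : r.-tuple 'I_n) := #|[set s : 'S_n | map_tuple s t == v]%SET|.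
have c_le (v v' : r.-tuple 'I_n) : uniq v -> uniq v' -> c v <= c v'.
  move=> uv uv'; have [g Eg] := uniq_tuple_extension uv uv'.
  rewrite /c -(card_imset _ (mulIg g)); apply/subset_leq_card/fintype.subsetP.
  move=> _ /imsetP[s + ->]; rewrite !inE => /eqP Es; apply/eqP; rewrite -Eg -Es.
  by apply: eq_from_tnth => i; rewrite !tnth_map permM.
have cE (v : r.-tuple 'I_n) : uniq v -> c v = c u.
  by move=> uv; apply/eqP; rewrite eqn_leq !c_le.
rewrite -[RHS](card_Sn n) -[in RHS]sum1_card.
transitivity (\sum_(s : 'S_n) \sum_(v : r.-tuple 'I_n | uniq v) (map_tuple s t == v)).
  rewrite exchange_big /= (eq_bigr (fun=> c u)); last first.
    move=> v uv; rewrite -(cE v uv) /c -sum1_card [RHS]big_mkcond /=.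
    by apply: eq_bigr => s _; rewrite inE; case: eqP.
  rewrite sum_nat_const mulnC; congr (_ * _).
  rewrite -[in LHS](card_ord n) -card_uniq_tuples.
  by apply: eq_card => v; rewrite !inE all_predT.
rewrite [RHS]big_mkcond; apply: eq_bigr => s _.
rewrite (bigD1 (map_tuple s t)) /=; last by rewrite map_inj_uniq //; exact: perm_inj.
rewrite eqxx big1 ?addn0 // => v /andP[_]; rewrite eq_sym => /negbTE -> //.
Qed.

Definition patterns r (P : pred (seq nat)) : {set r.-tuple 'I_n} :=
  [set u : r.-tuple 'I_n | uniq u && P (map val u)].

(** In product form: the values at fixed distinct positions form a uniformly random injective tuple.
    This is [card_perm_map] summed over the patterns. *)
Lemma card_perm_pattern r (t : r.-tuple 'I_n) (P : pred (seq nat)) : uniq t ->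
  #|[set s : 'S_n | P (map (fun i => val (s i)) t)]%SET| * n ^_ r
  = #|patterns r P| * n`!.
Proof.
move=> ut; rewrite -[X in X * _ = _]sum1_card.
transitivity ((\sum_(u in patterns r P) #|[set s : 'S_n | map_tuple s t == u]%SET|) * n ^_ r).
  congr (_ * _).
  under [RHS]eq_bigr do rewrite -sum1_card big_mkcond.
  rewrite exchange_big big_mkcond /=; apply: eq_bigr => s _; rewrite inE.
  have E : map (fun i => val (s i)) t = map val (map_tuple s t) by rewrite /= -map_comp.
  case: ifPn => Ps.
    rewrite (bigD1 (map_tuple s t)) /=; last first.
      by rewrite inE -E Ps map_inj_uniq ?ut //; exact: perm_inj.
    rewrite inE eqxx big1 // => u /andP[_ nu].
    by rewrite inE eq_sym (negbTE nu).
  rewrite big1 // => u; rewrite !inE => /andP[_ Pu].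
  by case: eqP => // Eu; move: Ps; rewrite E Eu Pu.
rewrite big_distrl /= (eq_bigr (fun=> n`!)) ?sum_nat_const // => u.
by rewrite inE => /andP[uu _]; exact: card_perm_map.
Qed.

Variables (r : nat) (P : pred (seq nat)).
Hypothesis r_gt0 : 0 < r.
Hypothesis P_take : forall s, P s = (r <= size s) && P (take r s).

Let window i : seq 'I_n := take r (drop i (enum 'I_n)).

Let uniq_window i : uniq (window i).
Proof.
by rewrite /window; apply: subseq_uniq (enum_uniq 'I_n); apply: subseq_trans (take_subseq _ _) (drop_subseq _ _).
Qed.

Let size_window i : i + r <= n -> size (window i) == r.
Proof.
by move=> ir; rewrite size_takel // size_drop size_enum_ord leq_subRL ?(leq_trans (leq_addr _ _) ir).
Qed.

Let P_window (s : 'S_n) i :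
  P (drop i (one_line s)) = (i + r <= n) && P (map (fun i => val (s i)) (window i)).
Proof.
rewrite P_take size_drop size_map size_enum_ord map_take map_drop.
case: (leqP i n) => [ir|ni]; first by rewrite leq_subRL.
rewrite (_ : n - i = 0) ?leqn0 ?(gtn_eqF r_gt0) /=; last by apply/eqP; rewrite subn_eq0 ltnW.
by rewrite leqNgt (leq_trans ni (leq_addr _ _)).
Qed.

Let mean_window i : i + r <= n ->
  (\sum_(s : 'S_n) P (drop i (one_line s))) * n ^_ r = #|patterns r P| * n`!.
Proof.
move=> ir; pose t := Tuple (size_window ir).
rewrite -(@card_perm_pattern _ t) ?uniq_window // -[in RHS]sum1_card [in RHS]big_mkcond.
congr (_ * _); apply: eq_bigr => s _.
by rewrite inE P_window ir /=; case: ifP.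
Qed.

(** Each of the [n.+1 - r] positions where a window fits contributes the same amount; the truncated
    difference is [0] when no window fits. *)
Lemma mean_suffix_count :
  (\sum_(s : 'S_n) suffix_count P (one_line s)) * n ^_ r
  = (n.+1 - r) * #|patterns r P| * n`!.
Proof.
under eq_bigr do rewrite suffix_countE size_map size_enum_ord.
rewrite exchange_big /= big_distrl /= (bigID (fun i : 'I_n => i + r <= n)) /=.
rewrite [X in _ + X]big1 ?addn0; last first.
  move=> i /negbTE ir; rewrite big1 // => s _.
  by rewrite P_window ir.
under eq_bigr do rewrite mean_window //.
rewrite sum_nat_const mulnA; congr (_ * _ * _).
have [rn|nr] := leqP r n; last first.
  rewrite (_ : n.+1 - r = 0); last by apply/eqP; rewrite subn_eq0.
  apply: eq_card0 => i; rewrite !inE.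
  by apply/negbTE; rewrite -ltnNge (leq_trans nr) ?leq_addl.
rewrite -[RHS]card_ord.
have le : n.+1 - r <= n by rewrite -(prednK r_gt0) subSS leq_subr.
have inj : injective (widen_ord le) by move=> i j /(congr1 val) /= /val_inj.
rewrite -[RHS](card_imset _ inj).
apply: eq_card => i; apply/idP/imsetP.
  move=> ir; have ilt : i < n.+1 - r by rewrite ltn_subRL addnC ltnS.
  by exists (Ordinal ilt) => //; apply: val_inj.
by move=> [j _ ->]; have := ltn_ord j; rewrite ltn_subRL addnC ltnS.
Qed.

Let pair (s : seq nat) := P (take r s) && P (drop r s).

(** Cutting a pair in the middle embeds it into the square of the patterns. There is only an
    inequality, because two patterns sharing a value do not concatenate to an injective tuple. *)
Let card_pair : #|patterns (r + r) pair| <= #|patterns r P| ^ 2.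
Proof.
rewrite -mulnn -cardsX.
apply: leq_trans (leq_imset_card (fun ab : r.-tuple 'I_n * r.-tuple 'I_n => cat_tuple ab.1 ab.2) _).
apply/subset_leq_card/fintype.subsetP => u; rewrite inE => /andP[uu /andP[P1 P2]].
have s1 : size (take r u) == r by rewrite size_takel // size_tuple leq_addr.
have s2 : size (drop r u) == r by rewrite size_drop size_tuple addnK.
apply/imsetP; exists (Tuple s1, Tuple s2); last by apply: val_inj; rewrite /= cat_take_drop.
move: uu; rewrite -{1}(cat_take_drop r u) cat_uniq => /and3P[u1 _ u2].
by rewrite !inE /= u1 u2 map_take map_drop P1 P2.
Qed.

(** Windows at distance at least [r] occupy disjoint positions, so together they form one pattern of
    length [r + r]. *)
Let pair_window i j : i + r <= j ->
  (\sum_(s : 'S_n) P (drop i (one_line s)) * P (drop j (one_line s))) * n ^_ (r + r)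
  <= #|patterns r P| ^ 2 * n`!.
Proof.
move=> irj; have [jr|nj] := leqP (j + r) n; last first.
  rewrite big1 // => s _; rewrite [P (drop j _)]P_window.
  by rewrite leqNgt nj /= muln0.
have ir : i + r <= n by exact: leq_trans irj (leq_trans (leq_addr _ _) jr).
apply: leq_trans (leq_mul card_pair (leqnn _)).
have sz : size (window i ++ window j) == r + r.
  by rewrite size_cat (eqP (size_window ir)) (eqP (size_window jr)).
pose t := Tuple sz.
have ut : uniq t.
  apply: subseq_uniq (enum_uniq 'I_n); rewrite /= -[X in subseq _ X](cat_take_drop j).
  apply: cat_subseq; last exact: take_subseq.
  rewrite /window take_drop; apply: subseq_trans (drop_subseq _ _) _.
  by rewrite -[X in subseq X _](@take_takel _ _ j) ?take_subseq // addnC.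
rewrite -(@card_perm_pattern _ t) // -[in X in _ <= X]sum1_card [in X in _ <= X]big_mkcond.
rewrite leq_mul2r; apply/orP; right; apply: leq_sum => s _.
rewrite inE !P_window ir jr /= map_cat /pair.
have sw : size [seq val (s i0) | i0 <- window i] = r.
  by rewrite size_map (eqP (size_window ir)).
rewrite take_cat drop_cat sw ltnn subnn take0 drop0 cats0.
by case: (P _); case: (P _).
Qed.

(** The square of the count is a sum over pairs of positions. For each position at most [r + r]
    others give an overlapping window, and these pairs are bounded trivially by [n!]; all remaining
    pairs fall under [pair_window]. *)
Lemma second_moment_suffix_count :
  (\sum_(s : 'S_n) suffix_count P (one_line s) ^ 2) * n ^_ (r + r)
  <= (n * (r + r) * n ^_ (r + r) + n ^ 2 * #|patterns r P| ^ 2) * n`!.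
Proof.
pose p i j := \sum_(s : 'S_n) P (drop i (one_line s)) * P (drop j (one_line s)).
have -> : \sum_(s : 'S_n) suffix_count P (one_line s) ^ 2
    = \sum_(i < n) \sum_(j < n) p i j.
  rewrite /p; under [RHS]eq_bigr do rewrite exchange_big /=.
  rewrite [RHS]exchange_big /=; apply: eq_bigr => s _.
  rewrite suffix_countE size_map size_enum_ord -mulnn big_distrl /=.
  by apply: eq_bigr => i _; rewrite big_distrr.
have p_sym i j : p i j = p j i by apply: eq_bigr => s _; rewrite mulnC.
have p_near i j : p i j <= n`!.
  rewrite -[X in _ <= X]card_Sn -sum1_card [in X in _ <= X]big_mkcond /=.
  by apply: leq_sum => s _; case: (P _); case: (P _).
pose near (i j : nat) := (j < i + r) && (i < j + r).
have p_bound i j : p i j * n ^_ (r + r) <=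
    near i j * n`! * n ^_ (r + r) + #|patterns r P| ^ 2 * n`!.
  rewrite /near; case: ltnP => [ji|]; last first.
    by move/pair_window => h; apply: leq_trans (leq_addl _ _).
  case: ltnP => [ij|]; last first.
    by move/pair_window => h; rewrite p_sym; apply: leq_trans (leq_addl _ _).
  by rewrite /= mul1n (leq_trans _ (leq_addr _ _)) // leq_mul2r p_near orbT.
have near_le (i : 'I_n) : \sum_(j < n) near i j <= r + r.
  rewrite -(big_mkord xpredT (fun j => nat_of_bool (near i j))) /index_iota subn0.
  rewrite (_ : \sum_(j <- _) _ = size [seq j <- iota 0 n | near i j]); last first.
    rewrite size_filter -sum1_count [RHS]big_mkcond.
    by apply: eq_bigr => j _; case: (near i j).
  (* The overlapping windows start among the [r + r] positions from [i - r] on, also when this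
     difference is truncated. *)
  rewrite -[X in _ <= X](size_iota (i - r)); apply: uniq_leq_size.
    by rewrite filter_uniq // iota_uniq.
  by move=> j; rewrite mem_filter !mem_iota /near; lia.
rewrite big_distrl /=.
apply: (@leq_trans (\sum_(i < n) ((r + r) * n`! * n ^_ (r + r) + n * (#|patterns r P| ^ 2 * n`!)))).
  apply: leq_sum => i _; rewrite big_distrl /=.
  apply: (@leq_trans (\sum_(j < n) (near i j * n`! * n ^_ (r + r) +
    #|patterns r P| ^ 2 * n`!))); first by apply: leq_sum.
  rewrite big_split /= sum_nat_const card_ord leq_add2r -!big_distrl /=.
  by rewrite !leq_mul2r near_le !orbT.
rewrite sum_nat_const card_ord; apply: eq_leq.
rewrite -mulnn; ring.
Qed.

End PermutationCounting.

(** * Limits of counting ratios and convergence in probability for uniform permutations *)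

Section Asymptotics.
Variable R : realType.
Implicit Types (m : nat -> nat) (a b : R).

Lemma cvg_nat_div (k : nat) : (fun n : nat => k%:R / n%:R : R) @ \oo --> (0 : R).
Proof.
apply/cvgrPdist_le => e e0; near=> n.
have n0 : 0 < n%:R :> R by near: n; exact: nbhs_infty_gtr.
rewrite sub0r normrN ger0_norm ?divr_ge0 // ler_pdivrMr // -ler_pdivrMl //.
by apply: ltW; near: n; exact: nbhs_infty_gtr.
Unshelve. all: by end_near. Qed.

Lemma cvg_subn_div m a (k : nat) :
  (fun n => (m n)%:R / n%:R) @ \oo --> a ->
  (fun n => (m n - k)%N%:R / n%:R) @ \oo --> a.
Proof.
move=> ma.
have E n : (m n - k)%N%:R / n%:R = (m n)%:R / n%:R - (minn (m n) k)%:R / n%:R :> R.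
  rewrite -mulrBl -natrB ?geq_minl //; congr (_%:R / _); lia.
under eq_fun do rewrite E.
rewrite -[a]subr0; apply: cvgB => //.
apply: (squeeze_cvgr _ (cvg_cst 0) (cvg_nat_div k)).
apply: nearW => n; rewrite divr_ge0 //= ler_wpM2r ?invr_ge0 ?ler0n //.
by rewrite ler_nat geq_minr.
Qed.

Lemma cvg_ffact m a (k : nat) :
  (fun n => (m n)%:R / n%:R) @ \oo --> a ->
  (fun n => (m n ^_ k)%:R / n%:R ^+ k) @ \oo --> a ^+ k.
Proof.
move=> ma; elim: k => [|k IH].
  by under eq_fun do rewrite ffactn0 expr0 divr1; exact: cvg_cst.
under eq_fun do rewrite ffactnSr natrM exprSr invfM mulrACA.
rewrite exprSr; apply: cvgM IH _.
exact: cvg_subn_div.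
Qed.

Lemma cvg_ratio1 : (fun n : nat => n%:R / n%:R : R) @ \oo --> (1 : R).
Proof.
apply: cvg_near_cst; near=> n.
rewrite /= divff // gt_eqF //; near: n; exact: nbhs_infty_gtr.
Unshelve. all: by end_near. Qed.

Lemma cvg_binomial m a (k : nat) :
  (fun n => (m n)%:R / n%:R) @ \oo --> a ->
  (fun n => 'C(m n, k)%:R / n%:R ^+ k) @ \oo --> a ^+ k / k`!%:R.
Proof.
move=> /(@cvg_ffact _ _ k) ma.
have E n : 'C(m n, k)%:R / n%:R ^+ k = (m n ^_ k)%:R / n%:R ^+ k / k`!%:R :> R.
  rewrite -bin_ffact natrM mulrAC mulfK // pnatr_eq0 -lt0n fact_gt0 //.
under eq_fun do rewrite E.
by apply: cvgM => //; exact: cvg_cst.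
Qed.

Definition whp (P : forall n, 'S_n -> bool) :=
  (fun n => uniform_pr R [set p : 'S_n | P n p]%SET) @ \oo --> (1 : R).

(** Passing to the exceptional permutations and clearing denominators turns union bounds into
    inclusions of finite sets. *)
Lemma whpP (P : forall n, 'S_n -> bool) : whp P <-> forall e : R, 0 < e ->
  \forall n \near \oo, #|[set p : 'S_n | ~~ P n p]%SET|%:R <= e * n`!%:R.
Proof.
have E n (e : R) : (`|1 - uniform_pr R [set p : 'S_n | P n p]%SET| <= e) =
    (#|[set p : 'S_n | ~~ P n p]%SET|%:R <= e * n`!%:R).
  have f0 : 0 < n`!%:R :> R by rewrite ltr0n fact_gt0.
  rewrite /uniform_pr (_ : #|{: 'S_n}| = n`!); last first.
    by rewrite -(card_Sn n); apply: eq_card => p; rewrite inE.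
  have : (#|[set p : 'S_n | P n p]%SET| + #|[set p : 'S_n | ~~ P n p]%SET| = n`!)%N.
    rewrite -(card_Sn n) -(cardsC [set p : 'S_n | P n p]%SET); congr (_ + _)%N.
    by apply: eq_card => p; rewrite !inE.
  move=> /(congr1 (fun k => k%:R : R)); rewrite natrD => cE.
  rewrite (_ : 1 - _ = #|[set p : 'S_n | ~~ P n p]%SET|%:R / n`!%:R).
    by rewrite ger0_norm ?divr_ge0 // ler_pdivrMr.
  by rewrite -cE; field; rewrite cE gt_eqF.
split=> [/cvgrPdist_le h e e0|h].
  by apply: filterS (h e e0) => n; rewrite E.
by apply/cvgrPdist_le => e e0; apply: filterS (h e e0) => n; rewrite E.
Qed.

Lemma whp_near (P Q : forall n, 'S_n -> bool) :
  (\forall n \near \oo, forall p : 'S_n, P n p -> Q n p) -> whp P -> whp Q.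
Proof.
move=> PQ /whpP hP; apply/whpP => e e0; near=> n.
apply: le_trans (_ : #|[set p : 'S_n | ~~ P n p]%SET|%:R <= _); last first.
  by near: n; exact: hP.
rewrite ler_nat; apply: subset_leq_card; apply/fintype.subsetP => p; rewrite !inE.
apply: contra; move: p; near: n; exact: PQ.
Unshelve. all: by end_near. Qed.

Lemma whp_and (P Q : forall n, 'S_n -> bool) :
  whp P -> whp Q -> whp (fun n p => P n p && Q n p).
Proof.
move=> /whpP hP /whpP hQ; apply/whpP => e e0; near=> n.
apply: (@le_trans _ _ (#|[set p : 'S_n | ~~ P n p]%SET|%:R + #|[set p : 'S_n | ~~ Q n p]%SET|%:R)).
  rewrite -natrD ler_nat; apply: leq_trans (leq_card_setU _ _).
  by apply: subset_leq_card; apply/fintype.subsetP => p; rewrite !inE negb_and.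
rewrite [e]splitr mulrDl; apply: lerD; near: n; [apply: hP|apply: hQ]; exact: divr_gt0.
Unshelve. all: by end_near. Qed.

(** Iterated union bound; the list of events does not grow with [n]. *)
Lemma whp_all (I : eqType) (r : seq I) (P : I -> forall n, 'S_n -> bool) :
  (forall i, whp (P i)) -> whp (fun n p => all (fun i => P i n p) r).
Proof.
move=> hP; elim: r => [|i r IH] /=; last exact: whp_and.
apply/whpP => e e0; near=> n.
rewrite eq_card0 => [|p]; last by rewrite !inE.
by rewrite mulr_ge0 // ltW.
Unshelve. all: by end_near. Qed.

Definition cvg_in_prob (Y : forall n, 'S_n -> R) (y : R) :=
  forall d : R, 0 < d -> whp (fun n p => `|Y n p - y| <= d).

Lemma cvg_in_prob_deterministic (Y : nat -> R) (y : R) :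
  Y @ \oo --> y -> cvg_in_prob (fun n _ => Y n) y.
Proof.
move=> /cvgrPdist_le hY d d0; apply/whpP => e e0; near=> n.
rewrite eq_card0 => [|p]; first by rewrite mulr_ge0 // ltW.
rewrite !inE; apply/negbTE; rewrite negbK distrC.
by near: n; exact: hY.
Unshelve. all: by end_near. Qed.

Lemma cvg_in_probD (Y Z : forall n, 'S_n -> R) (y z : R) :
  cvg_in_prob Y y -> cvg_in_prob Z z ->
  cvg_in_prob (fun n p => Y n p + Z n p) (y + z).
Proof.
move=> hY hZ d d0; have d2 : 0 < d / 2 by exact: divr_gt0.
apply: whp_near (whp_and (hY _ d2) (hZ _ d2)).
apply: nearW => n p /andP[h1 h2].
rewrite opprD addrACA [d]splitr; apply: le_trans (ler_normD _ _) _.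
exact: lerD.
Qed.

Lemma cvg_in_prob_sum (k : nat) (Y : nat -> forall n, 'S_n -> R) (y : nat -> R) :
  (forall i, cvg_in_prob (Y i) (y i)) ->
  cvg_in_prob (fun n p => \sum_(i < k) Y i n p) (\sum_(i < k) y i).
Proof.
move=> hY; elim: k => [|k IH].
  move=> d d0; apply: whp_near (cvg_in_prob_deterministic (cvg_cst 0) d0).
  by apply: nearW => n p; rewrite !big_ord0.
move=> d d0; apply: whp_near (cvg_in_probD IH (hY k) d0).
by apply: nearW => n p; rewrite !big_ord_recr.
Qed.

(* Chebyshev's inequality *)
Lemma cvg_in_prob_mean_square (Y : forall n, 'S_n -> R) (y : R) :
  (fun n => (\sum_(p : 'S_n) (Y n p - y) ^+ 2) / n`!%:R) @ \oo --> (0 : R) ->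
  cvg_in_prob Y y.
Proof.
move=> /cvgrPdist_le hY d d0; apply/whpP => e e0.
have ed : 0 < e * d ^+ 2 by rewrite mulr_gt0 // exprn_gt0.
near=> n; have f0 : 0 < n`!%:R :> R by rewrite ltr0n fact_gt0.
have : `|0 - (\sum_(p : 'S_n) (Y n p - y) ^+ 2) / n`!%:R| <= e * d ^+ 2.
  by near: n; apply: hY.
have S0 : 0 <= \sum_(p : 'S_n) (Y n p - y) ^+ 2.
  by apply: sumr_ge0 => p _; exact: sqr_ge0.
rewrite sub0r normrN ger0_norm ?divr_ge0 // ler_pdivrMr // => le.
rewrite -(ler_pM2r (exprn_gt0 2 d0)) mulrAC; apply: le_trans le.
rewrite -sum1_card natr_sum big_distrl /= big_mkcond; apply: ler_sum => p _.
rewrite inE -ltNge; case: ifP => [le|_]; last exact: sqr_ge0.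
rewrite mul1r -[leRHS]real_normK ?num_real // ler_sqr ?nnegrE ?(ltW d0) //.
exact: ltW.
Unshelve. all: by end_near. Qed.

(** Second moment method: the mean of the rescaled count tends to [y], and its second moment is at
    most [y^2] up to a vanishing term. The predicate may vary with [n], as the thresholds of the
    chains do. *)
Lemma cvg_in_prob_suffix_count (r : nat) (P : nat -> pred (seq nat)) (y : R) :
  (0 < r)%N ->
  (forall n s, P n s = (r <= size s)%N && P n (take r s)) ->
  (fun n => #|patterns n r (P n)|%:R / n%:R ^+ r) @ \oo --> y ->
  cvg_in_prob (fun n p => (suffix_count (P n) (one_line p))%:R / n%:R) y.
Proof.
move=> r0 Ptake hP; apply: cvg_in_prob_mean_square.
pose t n : R := #|patterns n r (P n)|%:R / n%:R ^+ r.
pose c k n : R := (n ^_ k)%:R / n%:R ^+ k.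
have hc k : c k @ \oo --> (1 : R).
  by rewrite -(expr1n R k); apply: cvg_ffact; exact: cvg_ratio1.
pose l n : R := (n.+1 - r)%N%:R / n%:R.
have hl : l @ \oo --> (1 : R).
  rewrite /l -(prednK r0); under eq_fun do rewrite subSS.
  by apply: cvg_subn_div; exact: cvg_ratio1.
(* [u] is the expanded mean square of the count over [n] minus [y], with the second moment replaced
   by its upper bound; its limit is [y^2 - 2 y^2 + y^2 = 0]. *)
pose u n : R := (r + r)%:R / n%:R + t n * t n * (c (r + r)%N n)^-1
   - 2 * y * (l n * t n * (c r n)^-1) + y * y.
have hu : u @ \oo --> (0 : R).
  have -> : 0 = 0 + y * y * 1^-1 - 2 * y * (1 * y * 1^-1) + y * y :> R.
    by rewrite invr1; ring.
  apply: cvgD; last exact: cvg_cst.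
  apply: cvgB.
    apply: cvgD; first exact: cvg_nat_div.
    by apply: cvgM; [exact: cvgM | apply: cvgV => //; exact: oner_neq0].
  apply: cvgM; first exact: cvg_cst.
  by apply: cvgM; [exact: cvgM | apply: cvgV => //; exact: oner_neq0].
apply: (squeeze_cvgr _ (cvg_cst 0) hu); near=> n.
have n0 : 0 < n%:R :> R by near: n; exact: nbhs_infty_gtr.
have nr : (r + r < n)%N.
  by rewrite -(ltr_nat R); near: n; exact: nbhs_infty_gtr.
have f0 : 0 < n`!%:R :> R by rewrite ltr0n fact_gt0.
rewrite divr_ge0 ?sumr_ge0 //=; last by move=> p _; exact: sqr_ge0.
rewrite ler_pdivrMr //.
pose N p : R := (suffix_count (P n) (one_line (n:=n) p))%:R.
rewrite (eq_bigr (fun p => N p ^+ 2 / n%:R ^+ 2 - (2 * y / n%:R) * N p + y ^+ 2)); last first.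
  by move=> p _; rewrite -/(N p); field; rewrite gt_eqF.
rewrite big_split sumrB /= -mulr_suml -mulr_sumr sumr_const.
have r1 : 0 < (n ^_ r)%:R :> R.
  by rewrite ltr0n ffact_gt0 (leq_trans (leq_addr _ _) (ltnW nr)).
have r2 : 0 < (n ^_ (r + r))%:R :> R by rewrite ltr0n ffact_gt0 ltnW.
have m1 : \sum_p N p = l n * t n * (c r n)^-1 * n%:R * n`!%:R.
  have r1n : (n ^_ r)%:R != 0 :> R by rewrite gt_eqF.
  apply: (mulIf r1n).
  rewrite /N -natr_sum -natrM mean_suffix_count // !natrM /l /t /c.
  by field; rewrite !gt_eqF // exprn_gt0.
have m2 : \sum_p N p ^+ 2 <=
    ((r + r)%:R / n%:R + t n * t n * (c (r + r)%N n)^-1) * n%:R ^+ 2 * n`!%:R.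
  rewrite -(ler_pM2r r2) /N.
  have -> : \sum_(p : 'S_n) (suffix_count (P n) (one_line p))%:R ^+ 2
     = (\sum_(p : 'S_n) suffix_count (P n) (one_line p) ^ 2)%N%:R :> R.
    by rewrite natr_sum; apply: eq_bigr => p _; rewrite natrX.
  rewrite -natrM; apply: le_trans (_ : _%:R <= _).
    by rewrite ler_nat; exact: second_moment_suffix_count.
  rewrite le_eqVlt; apply/orP; left; apply/eqP.
  rewrite !(natrM, natrD, natrX) /t /c exprD.
  by field; rewrite !gt_eqF // exprn_gt0.
rewrite m1 (_ : #|_| = n`!); last first.
  by rewrite -(card_Sn n); apply: eq_card => p; rewrite inE.
apply: (@le_trans _ _ (((r + r)%:R / n%:R + t n * t n * (c (r + r)%N n)^-1) * n%:R ^+ 2 * n`!%:R / n%:R ^+ 2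
    - 2 * y / n%:R * (l n * t n / c r n * n%:R * n`!%:R) + y ^+ 2 *+ n`!)).
  by rewrite lerD2r lerD2r; apply: ler_wpM2r => //; rewrite invr_ge0 exprn_ge0.
rewrite le_eqVlt; apply/orP; left; apply/eqP; rewrite /u -mulr_natr.
move: (c r n)^-1 (c (r + r)%N n)^-1 => x z.
by field; rewrite gt_eqF.
Unshelve. all: by end_near. Qed.

End Asymptotics.

(** * Cardinalities of the window patterns, and exact counts of early entries *)

Section ChainPatterns.
Local Open Scope nat_scope.

Lemma card_incr_patterns n k : #|patterns n k.+1 (incr_at k)| = 'C(n, k.+1).
Proof.
rewrite -card_ltn_sorted_tuples; apply: eq_card => u; rewrite !inE.
rewrite /incr_at size_map size_tuple leqnn take_oversize ?size_map ?size_tuple //=.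
case: (boolP (sorted _ _)) => su; last by rewrite andbF.
by rewrite andbT -(map_inj_uniq val_inj) (sorted_uniq ltn_trans ltnn).
Qed.

Lemma chain_lt A B k p s : chain A B k p s -> p < B.
Proof.
elim: k p s => [|k IH] p [|v s] //= /and3P[_ pv /IH]; exact: ltn_trans.
Qed.

(** Along an increasing window the bound by [B] on the last letter bounds them all. The ascent out
    of [x] is implied by [x < A], and for empty [s] the test [x < B] follows from [A <= B]. *)
Lemma chain_at_cons A B k x s : A <= B -> size s = k ->
  chain_at A B k (x :: s)
  = [&& x < A, sorted ltn s & all (fun v => A <= v < B) s].
Proof.
move=> AB sk; rewrite /=; case: ltnP => //= xA.
have -> : chain A B k x s = path ltn x s && all (fun v => A <= v < B) s.
  have xB := leq_trans xA AB.
  elim: s k x xB {xA} sk => [|v s IH] k x xB <- //=.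
  rewrite (_ : _ && all _ s = all (fun v => A <= v < B) (v :: s)) //=.
  have [vB|Bv] := ltnP v B.
    rewrite (IH _ _ vB erefl) andbT; case: (A <= v); rewrite ?andbF //.
    by case: (x < v).
  rewrite andbF !andbF.
  by case: (boolP (chain _ _ _ _ _)) => [/chain_lt|]; rewrite ?andbF // ltnNge Bv.
case: s {sk} => //= v s.
by have [Av|] := leqP A v; rewrite ?andbF // (leq_trans xA Av).
Qed.

(** The first letter is any value below [A], and the others are a [k]-subset of the values in
    [[A, B)] listed in increasing order. *)
Lemma card_chain_patterns n A B k : A <= B <= n ->
  #|patterns n k.+1 (chain_at A B k)| = A * 'C(B - A, k).
Proof.
move=> /andP[AB Bn].
have ltg (j : 'I_(B - A)) : A + j < n.
  by apply: leq_trans Bn; rewrite -ltn_subRL.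
(* [g] shifts ['I_(B - A)] onto the values in [[A, B)]; with the inclusion [h] of ['I_A] it gives
   the bijection [f] onto the patterns. *)
pose g j := Ordinal (ltg j).
have ginj : injective g by move=> i j /(congr1 val) /= /addnI/val_inj.
pose h := widen_ord (leq_trans AB Bn).
have hinj : injective h by move=> i j /(congr1 val) /= /val_inj.
have glift (s : seq 'I_n) : all (fun v => A <= v < B) (map val s) ->
    exists v, s = map g v.
  elim: s => [_|y s IH] /=; first by exists [::].
  move=> /andP[/andP[Ay yB] /IH[v ->]].
  have yl : y - A < B - A by rewrite ltn_sub2r // (leq_ltn_trans Ay).
  by exists (Ordinal yl :: v) => /=; congr cons; apply: val_inj; rewrite /= subnKC.
have gsorted (v : seq 'I_(B - A)) :
    sorted ltn (map val (map g v)) = sorted ltn (map val v).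
  rewrite -map_comp !sorted_map; apply: eq_sorted => i j /=.
  by rewrite ltn_add2l.
pose f (av : 'I_A * k.-tuple 'I_(B - A)) := cons_tuple (h av.1) (map_tuple g av.2).
have finj : injective f.
  move=> [a v] [a' v'] /(congr1 val) /= [ha /(inj_map ginj) hv].
  by congr pair; [apply: val_inj | apply: val_inj].
rewrite -[in RHS]card_ltn_sorted_tuples -[X in X * _](card_ord A) -cardsT -cardsX.
rewrite -(card_imset _ finj); apply: eq_card => u; rewrite inE.
apply/andP/imsetP => [[]|].
  case/tupleP: u => x s ux; rewrite /= -/(chain_at A B k (val x :: map val s)).
  rewrite chain_at_cons ?size_map ?size_tuple // => /and3P[xA ss sAB].
  have [v Ev] := glift _ sAB.
  have vk : size v == k by rewrite -(size_map g) -Ev size_tuple.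
  exists (Ordinal xA, Tuple vk); first by rewrite !inE /= -gsorted -Ev.
  by apply: val_inj; rewrite /= Ev; congr cons; apply: val_inj.
move=> [[a v]]; rewrite !inE /= => vs ->; rewrite -/(chain_at A B k (val (h a) :: map val (map g v))).
have inAB : all (fun v => A <= v < B) (map val (map g v)).
  rewrite -map_comp; apply/allP => _ /mapP[j _ ->] /=.
  by rewrite leq_addr -ltn_subRL ltn_ord.
have hA : val (h a) < A := ltn_ord a.
rewrite chain_at_cons ?size_map ?size_tuple // gsorted vs inAB hA; split => //.
rewrite cons_uniq; apply/andP; split; last first.
  by rewrite -(map_inj_uniq val_inj) (sorted_uniq ltn_trans ltnn) // gsorted.
apply/negP => /(map_f val) /(allP inAB) /= /andP[+ _].
by rewrite leqNgt ltn_ord.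
Qed.

(** A run containing an entry below [B] starts at or below that entry, hence below [A], so no such
    entry is missed. *)
Lemma early_count_ge A B s : B <= A ->
  count (fun u => u < B) (early A s) = count (fun u => u < B) s.
Proof.
move=> BA; rewrite -[in RHS](flatten_runs s) /early.
have runs_sorted : all (sorted ltn) (runs s).
  elim: s => [|x s] //; have [r [rs [-> pr ->]]] := runs_cons x s.
  rewrite /= pr; case: s => [|y s] //; case: ifP => //= _ /andP[] //.
elim: (runs s) runs_sorted => [|r rs IH] //= /andP[sr /IH {}IH].
rewrite count_cat -IH; case: ifP => [_|rA] /=; first by rewrite count_cat.
rewrite [X in _ = X + _](_ : _ = 0) //; apply/eqP; rewrite -leqn0 leqNgt -has_count.
apply/hasP => -[u + uB]; case: r sr rA => // x r /= pr /negbT; rewrite -leqNgt => Ax.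
rewrite inE => /orP[/eqP ux|ur].
  by move: uB; rewrite ux ltnNge (leq_trans BA Ax).
have /allP/(_ u ur) := order_path_min ltn_trans pr => /= xu.
by move: uB; rewrite ltnNge (leq_trans BA) // (leq_trans Ax) // ltnW.
Qed.

Lemma count_one_line n (p : 'S_n) B : B <= n ->
  count (fun u => u < B) (one_line p) = B.
Proof.
move=> Bn; rewrite (seq.permP (perm_one_line p)) -(subnKC Bn) iotaD count_cat add0n.
rewrite (_ : count _ (iota 0 B) = B); last first.
  rewrite -[RHS](size_iota 0 B); apply/eqP; rewrite -all_count; apply/allP => u.
  by rewrite mem_iota.
rewrite (_ : count _ (iota B _) = 0) ?addn0 //.
apply/eqP; rewrite -leqn0 leqNgt -has_count; apply/hasP => -[u].
by rewrite mem_iota => /andP[Bu _]; rewrite ltnNge Bu.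
Qed.

End ChainPatterns.

(** * Limit in probability of the number of early entries below a threshold *)

Section EarlyLimit.
Variable R : realType.
Variables (A B : nat -> nat) (a b : R).
Hypothesis B_le : forall n, (B n <= n)%N.
Hypothesis limA : (fun n => (A n)%:R / n%:R) @ \oo --> a.
Hypothesis limB : (fun n => (B n)%:R / n%:R) @ \oo --> b.

Let X n (p : 'S_n) : R :=
  (count (fun u => (u < B n)%N) (early (A n) (one_line p)))%:R / n%:R.

Lemma cvg_in_prob_early_ge : (forall n, (B n <= A n)%N) -> cvg_in_prob X b.
Proof.
move=> BA d d0; apply: whp_near (cvg_in_prob_deterministic limB d0).
apply: nearW => n p.
by rewrite /X early_count_ge // count_one_line.
Qed.

(** The chains with [k < K] give [a] times a partial sum of the exponential series, and the others
    are bounded by the increasing windows of length [K + 1], whose proportion tends to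
    [1 / (K + 1)!]. *)
Lemma cvg_in_prob_early_le : (forall n, (A n <= B n)%N) ->
  cvg_in_prob X (a * expR (b - a)).
Proof.
move=> AB.
pose N k n (p : 'S_n) : R :=
  (suffix_count (chain_at (A n) (B n) k) (one_line p))%:R / n%:R.
pose y k : R := a * exp_coeff (b - a) k.
have cvgN k : cvg_in_prob (N k) (y k).
  apply: (cvg_in_prob_suffix_count (ltn0Sn k)) => [n s|].
    by rewrite chain_at_take.
  have E n : #|patterns n k.+1 (chain_at (A n) (B n) k)|%:R / n%:R ^+ k.+1
      = (A n)%:R / n%:R * ('C(B n - A n, k)%:R / n%:R ^+ k) :> R.
    rewrite card_chain_patterns ?AB ?B_le // natrM exprS invfM.
    by rewrite mulrACA.
  under eq_fun do rewrite E.
  apply: cvgM limA _; apply: cvg_binomial.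
  under eq_fun do rewrite natrB // mulrBl.
  exact: cvgB.
have cvgW k : cvg_in_prob
    (fun n p => (suffix_count (incr_at k) (one_line p))%:R / n%:R : R) (k.+1`!%:R^-1).
  apply: (cvg_in_prob_suffix_count (P := fun=> incr_at k) (ltn0Sn k)) => [n s|].
    by rewrite /incr_at; case: ltnP => //= ks; rewrite size_takel // ltnSn take_takel.
  have -> : k.+1`!%:R^-1 = 1 ^+ k.+1 / k.+1`!%:R :> R by rewrite expr1n mul1r.
  under eq_fun do rewrite card_incr_patterns.
  by apply: (cvg_binomial (m := id)); exact: cvg_ratio1.
move=> d d0; have d4 : 0 < d / 4 by exact: divr_gt0.
(* The error [d] is split into quarters: the remainder of the series, the limit [1 / (K + 1)!] of
   the tail, and the deviations of the truncated sum and of the tail from their limits. *)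
have [K [K1 K2]] : exists K, `|a * expR (b - a) - \sum_(k < K) y k| <= d / 4 /\
    K.+1`!%:R^-1 <= d / 4.
  have cs : (fun K => a * series (exp_coeff (b - a)) K) @ \oo --> a * expR (b - a).
    by apply: cvgM; [exact: cvg_cst | exact: is_cvg_series_exp_coeff].
  have [K [hK1 hK2]] : exists K : nat, `|a * expR (b - a) - a * series (exp_coeff (b - a)) K| <= d / 4
      /\ (d / 4)^-1 < K%:R.
    near \oo => K; exists K; split; near: K; last exact: nbhs_infty_gtr.
    by move/cvgrPdist_le : cs; apply.
  exists K; split; first by rewrite /y -mulr_sumr -(big_mkord xpredT (exp_coeff _)).
  rewrite invf_ple ?posrE ?ltr0n ?fact_gt0 //.
  apply: le_trans (ltW hK2) _; rewrite ler_nat.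
  by rewrite (leq_trans (leqnSn K)) // fact_geq.
apply: whp_near (whp_and (cvg_in_prob_sum K cvgN d4) (cvgW K _ d4)).
near=> n => p /andP[hN hW].
have n0 : 0 < n%:R :> R by near: n; exact: nbhs_infty_gtr.
set S := \sum_(k < K) N k n p in hN.
set W := _ / _ in hW.
have XS : S <= X p <= S + W.
  have -> : S = (\sum_(k < K) suffix_count (chain_at (A n) (B n) k) (one_line p))%N%:R / n%:R.
    by rewrite /S /N natr_sum mulr_suml.
  (* The cutoff [K + n] is at least the length [n] of the word and leaves room to split the sum at
     [K]. *)
  rewrite /X (@early_count _ _ (K + n)) ?(perm_size (perm_one_line p)) ?size_iota ?leq_addl //.
  have -> : (\sum_(k < K + n) suffix_count (chain_at (A n) (B n) k) (one_line p)
      = \sum_(k < K) suffix_count (chain_at (A n) (B n) k) (one_line p)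
      + \sum_(K <= k < K + n) suffix_count (chain_at (A n) (B n) k) (one_line p))%N.
    by rewrite -!(big_mkord xpredT (fun k => suffix_count (chain_at _ _ k) _)) -big_cat_nat ?leq_addr.
  rewrite /W -mulrDl !ler_pM2r ?invr_gt0 // -natrD !ler_nat leq_addr leq_add2l.
  exact: suffix_count_tail.
move: XS hN hW K1 K2; rewrite !ler_norml.
move: (a * _) (K.+1`!%:R^-1) (\sum_(_ < _) _) => t w s.
lra.
Unshelve. all: by end_near. Qed.

End EarlyLimit.

(** * The permuton of a permutation: marginals and masses of corners *)

Section PermPermuton.
Variables (R : realType) (n : nat) (p : 'S_n).
Hypothesis n_gt0 : (0 < n)%N.

Local Notation mu := (@lebesgue_measure R).
Local Notation mu2 := (mu \x mu)%E.

Let cell (k : nat) : set R := `[k%:R / n%:R, k.+1%:R / n%:R[.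

Let n0 : 0 < n%:R :> R.
Proof. by rewrite ltr0n. Qed.

Let mu_cell k : mu (cell k) = (n%:R^-1)%:E.
Proof.
rewrite lebesgue_measure_itv /= lte_fin ltr_pM2r ?invr_gt0// ltr_nat ltnSn.
by rewrite -EFinD -mulrBl -natrB// subSnn mul1r.
Qed.

Let cell_le (i j : nat) (x : R) : cell i x -> cell j x -> (i <= j)%N.
Proof.
rewrite /cell /= !in_itv /= => /andP[ix _] /andP[_ xj].
by have := le_lt_trans ix xj; rewrite ltr_pM2r ?invr_gt0// ltr_nat ltnS.
Qed.

Let cell_inj (i j : nat) (x : R) : cell i x -> cell j x -> i = j.
Proof.
by move=> xi xj; apply/eqP; rewrite eqn_leq (cell_le xi xj) (cell_le xj xi).
Qed.

Let measurable_cell k : measurable (cell k).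
Proof. exact: measurable_itv. Qed.

Let measure_ord_bigcup d (T : measurableType d) (m : {measure set T -> \bar R})
    (F : 'I_n -> set T) : trivIset setT F -> (forall i, measurable (F i)) ->
  m (\bigcup_i F i) = (\sum_(i < n) m (F i))%E.
Proof.
move=> tF mF; rewrite measure_fin_bigcup//; last exact: finite_finset.
rewrite (_ : [set: 'I_n] = [set` enum 'I_n]); last first.
  by apply/seteqP; split => i //= _; rewrite mem_enum.
by rewrite -fsbig_seq ?enum_uniq//= big_enum.
Qed.

Lemma perm_permutonX (E1 E2 : set R) : measurable E1 -> measurable E2 ->
  perm_permuton p (E1 `*` E2) = (n%:R%:E *
    \sum_(k < n) mu (cell k `&` E1) * mu (cell (p k) `&` E2))%E.
Proof.
move=> m1 m2; rewrite /perm_permuton /perm_density.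
under eq_integral do rewrite EFinM.
have mU : measurable (\bigcup_i @perm_square R n p i).
  by apply: fin_bigcup_measurable => // i _; exact: measurable_perm_square.
rewrite ge0_integralZl//; last 2 first.
- exact: measurableX.
- by apply/measurable_EFinP; exact: measurable_indic.
rewrite integral_indic//; last exact: measurableX.
congr (_ * _)%E; rewrite setI_bigcupl.
rewrite [LHS]measure_ord_bigcup; last 2 first.
- move=> i j _ _ [[x y] [[[/= xi _] _] [[/= xj _] _]]].
  by apply: val_inj; exact: cell_inj xi xj.
- move=> i; apply: measurableI; first exact: measurable_perm_square.
  exact: measurableX.
apply: eq_bigr => k _.
by rewrite /perm_square -setXI; apply: product_measure1E; exact: measurableI.
Qed.

Let sum_cell (E : set R) : measurable E ->
  (\sum_(k < n) mu (cell k `&` E) <= mu E)%E.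
Proof.
move=> mE; rewrite -measure_ord_bigcup.
- apply: le_measure; rewrite ?inE //; last by move=> x [k _ [_ Ex]].
  by apply: fin_bigcup_measurable => // k _; exact: measurableI (measurable_cell k) mE.
- by move=> i j _ _ [x [[xi _] [xj _]]]; apply: val_inj; exact: cell_inj xi xj.
- by move=> k; exact: measurableI (measurable_cell k) mE.
Qed.

Let nVK (x : \bar R) : (n%:R%:E * (x * n%:R^-1%:E) = x)%E.
Proof.
by rewrite muleCA -EFinM divff ?mule1 // gt_eqF.
Qed.

Let nVsum (F : 'I_n -> \bar R) : (forall k, 0 <= F k)%E ->
  (n%:R%:E * (\sum_(k < n) F k * n%:R^-1%:E) = \sum_(k < n) F k)%E.
Proof. by move=> F0; rewrite -ge0_sume_distrl // nVK. Qed.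

(** The other side of each square has length [1 / n], which cancels the density: the marginal is
    uniform on [[0, 1)], and [E] may leave that interval. Used to bound strips and to see that lines
    are null. *)
Lemma perm_permuton_vertical (E : set R) : measurable E ->
  (perm_permuton p (E `*` setT) <= mu E)%E.
Proof.
move=> mE; rewrite perm_permutonX //.
under eq_bigr do rewrite setIT mu_cell.
by rewrite nVsum // sum_cell.
Qed.

Lemma perm_permuton_horizontal (E : set R) : measurable E ->
  (perm_permuton p (setT `*` E) <= mu E)%E.
Proof.
move=> mE; rewrite perm_permutonX //.
under eq_bigr do rewrite setIT mu_cell muleC.
rewrite nVsum //; apply: le_trans (sum_cell mE).
by rewrite [leRHS](reindex_inj (@perm_inj _ p)).
Qed.

Let mu_cell_below k i : mu (cell k `&` `[0, i%:R / n%:R[) = ((k < i)%:R / n%:R)%:E.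
Proof.
have [ki|ik] := ltnP k i.
  rewrite setIidl ?mu_cell ?mul1r // => x; rewrite /cell /= !in_itv /= => /andP[kx xk].
  rewrite (le_trans _ kx) ?divr_ge0 //= (lt_le_trans xk) //.
  by rewrite ler_pM2r ?invr_gt0 // ler_nat.
rewrite mul0r (_ : _ `&` _ = set0) ?measure0 //.
apply/seteqP; split => // x []; rewrite /cell /= !in_itv /= => /andP[kx _] /andP[_ xi].
have := le_lt_trans kx xi.
by rewrite ltr_pM2r ?invr_gt0// ltr_nat ltnNge ik.
Qed.

Lemma count_take_sum (w : seq nat) i j :
  count (fun u => u < j)%N (take i w)
  = (\sum_(k < size w) ((k < i) && (nth 0 w k < j)))%N.
Proof.
elim: w i => [|u w IH] i; first by rewrite big_ord0.
by case: i => [|i]; [rewrite big1 | rewrite big_ord_recl /= IH].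
Qed.

(** A corner at a grid point contains each square entirely or misses it, so the mass is a count of
    points of the permutation. *)
Lemma perm_permuton_corner i j :
  perm_permuton p (`[0, i%:R / n%:R[ `*` `[0, j%:R / n%:R[)
  = ((count (fun u => u < j)%N (take i (one_line p)))%:R / n%:R)%:E :> \bar R.
Proof.
rewrite perm_permutonX // count_take_sum (perm_size (perm_one_line p)) size_iota.
rewrite natr_sum mulr_suml -sumEFin -[RHS]nVsum; last first.
  by move=> k; rewrite lee_fin divr_ge0.
congr (_ * _)%E; apply: eq_bigr => k _; rewrite !mu_cell_below -!EFinM; congr EFin.
rewrite /one_line (nth_map k) ?size_enum_ord // nth_ord_enum.
by case: (k < i)%N; case: (p k < j)%N; rewrite /= ?mul0r ?mul1r // ?mulr0.
Qed.

End PermPermuton.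

(** * The runsort permuton: null lines and masses of corners *)

Section RunsortPermuton.
Variable R : realType.

Local Notation mu := (@lebesgue_measure R).
Local Notation mu2 := (mu \x mu)%E.

Definition curve_fst (y : R) : R := y * expR (1 - y).

(** After division by [expR (1 - t)] the claim is [s < t * expR (s - t)]; it follows from
    [1 + (s - t) < expR (s - t)], because [t * (1 + (s - t)) - s = (t - s) * (1 - t)] is
    nonnegative. *)
Lemma curve_fst_lt s t : 0 <= s -> s < t -> t <= 1 -> curve_fst s < curve_fst t.
Proof.
move=> s0 st t1; have d0 : 0 < t - s by rewrite subr_gt0.
have -> : curve_fst s = s * expR (t - s) * expR (1 - t).
  by rewrite /curve_fst -mulrA -expRD; congr (_ * expR _); ring.
rewrite ltr_pM2r ?expR_gt0 //.
have -> : t - s = - (s - t) by rewrite opprB.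
rewrite expRN ltr_pdivrMr ?expR_gt0 //.
have : 1 + (s - t) < expR (s - t) by rewrite expR_gt1Dx // subr_eq0 lt_eqF.
move=> h; apply: le_lt_trans (_ : t * (1 + (s - t)) < _); last first.
  by rewrite ltr_pM2l // (le_lt_trans s0).
nra.
Qed.

Lemma curve_fst_le s t : 0 <= s -> s <= t -> t <= 1 -> curve_fst s <= curve_fst t.
Proof.
move=> s0; rewrite le_eqVlt => /orP[/eqP -> //|st t1].
exact/ltW/curve_fst_lt.
Qed.

Lemma curve_fst_ge0 s : 0 <= s -> 0 <= curve_fst s.
Proof. by move=> s0; rewrite mulr_ge0 ?expR_ge0. Qed.

Lemma curve_fst1 : curve_fst 1 = 1.
Proof. by rewrite /curve_fst subrr expR0 mulr1. Qed.

Lemma curve_fst_le1 s : 0 <= s <= 1 -> curve_fst s <= 1.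
Proof. by move=> /andP[s0 s1]; rewrite -curve_fst1 curve_fst_le. Qed.

Lemma continuous_curve_fst : continuous curve_fst.
Proof.
move=> y; apply: cvgM; first exact: cvg_id.
apply: continuous_comp; last exact: continuous_expR.
by apply: cvgB; [exact: cvg_cst | exact: cvg_id].
Qed.

Lemma curve_fst_surj x : 0 <= x <= 1 -> exists2 a, 0 <= a <= 1 & curve_fst a = x.
Proof.
move=> x01; have [||a a01 ax] := @IVT R curve_fst 0 1 x ler01.
- exact/continuous_subspaceT/continuous_curve_fst.
- have -> : curve_fst 0 = 0 by rewrite /curve_fst mul0r.
  by rewrite curve_fst1 minEle maxEle ler01.
by exists a => //; move: a01; rewrite in_itv.
Qed.

Let measurable_exp_snd (D : set (R * R)) : measurable D ->
  measurable_fun D (fun z : R * R => (expR (z.2 - 1))%:E).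
Proof.
move=> mD; apply/measurable_EFinP/measurable_funTS/measurableT_comp => //.
exact: measurable_funB.
Qed.

Let measurable_curve_preimage (B : set (R * R)) : measurable B ->
  measurable [set y : R | (B `&` curveC) (curve y)].
Proof.
move=> mB; rewrite (_ : mkset _ = curve @^-1` (B `&` curveC)) //.
rewrite -[X in measurable X]setTI; apply: measurable_curve => //.
exact: measurableI mB measurable_curveC.
Qed.

Let mu2X (A B : set R) : measurable A -> measurable B ->
  mu2 (A `*` B) = (mu A * mu B)%E.
Proof. by move=> mA mB; exact: product_measure1E. Qed.

Let runsort_permuton_null (B : set (R * R)) (y : R) : measurable B ->
  mu2 B = 0%E -> [set y : R | (B `&` curveC) (curve y)] `<=` [set y] ->
  runsort_permuton B = 0%E.
Proof.
move=> mB B0 By; rewrite /runsort_permuton.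
have mC := @measurable_curveC_plus R.
rewrite null_set_integral ?add0e; last 3 first.
- exact: measurableI.
- by apply: measurable_exp_snd; exact: measurableI.
- apply: (@subset_measure0 _ _ _ mu2 _ B) => //; exact: measurableI.
apply: null_set_integral.
- exact: measurable_curve_preimage.
- by apply/measurable_EFinP/measurable_funTS; exact: measurable_funB.
- apply: (@subset_measure0 _ _ _ mu _ [set y]) => //.
  + exact: measurable_curve_preimage.
  + exact: lebesgue_measure_set1.
Qed.

(** By strict monotonicity of [curve_fst], a vertical line meets the curve in at most one point. *)
Lemma runsort_permuton_vertical (x : R) :
  runsort_permuton ([set x] `*` setT) = 0%E.
Proof.
set B := [set x] `*` setT.
have mB : measurable B by apply: measurableX.
have B0 : mu2 B = 0%E by rewrite mu2X // lebesgue_measure_set1 mul0e.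
have [[y By]|nB] := pselect (exists y, (B `&` curveC) (curve y)); last first.
  (* The line misses the curve, so the exceptional parameter [0] is arbitrary. *)
  apply: (runsort_permuton_null (y := 0)) => // y By.
  by case: nB; exists y.
apply: (runsort_permuton_null (y := y)) => // t [[/= tx _] Ct].
case: By => [[/= yx _] Cy].
move/curve_curveC : Ct; move/curve_curveC : Cy; rewrite !in_itv /= => /andP[y0 y1] /andP[t0 t1].
have E : curve_fst t = curve_fst y by rewrite /curve_fst tx yx.
have [ty|yt|] := ltgtP t y => //.
- by have := curve_fst_lt t0 ty y1; rewrite E ltxx.
- by have := curve_fst_lt y0 yt t1; rewrite E ltxx.
Qed.

Lemma runsort_permuton_horizontal (y : R) :
  runsort_permuton (setT `*` [set y]) = 0%E.
Proof.
apply: (runsort_permuton_null (y := y)) => //.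
- exact: measurableX.
- by rewrite mu2X // lebesgue_measure_set1 mule0.
- by move=> t [[]].
Qed.

Lemma integral_expR (c a b : R) : a < b ->
  (\int[mu]_(t in `[a, b[) (c * expR (t - 1))%:E
   = (c * expR (b - 1) - c * expR (a - 1))%:E)%E.
Proof.
move=> ab; pose F t : R := c * expR (t - 1).
have dF (t : R) : is_derive t 1 F (F t).
  rewrite /F; apply: is_derive_eq.
  by rewrite /GRing.scale /= !(mulr1, mulr0, addr0, add0r, subr0).
have cF : continuous F.
  by move=> t; apply: differentiable_continuous; apply/derivable1_diffP; exact: ex_derive.
rewrite integral_itv_bndo_bndc; last first.
  by apply/measurable_EFinP/measurable_funTS; exact: continuous_measurable_fun.
rewrite (continuous_FTC2 (F := F) ab).
- by rewrite -EFinB.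
- exact: continuous_subspaceT.
- split => [t _||]; first exact: ex_derive.
  + by apply: cvg_at_right_filter; exact: cF.
  + by apply: cvg_at_left_filter; exact: cF.
- by move=> t _; rewrite derive1E derive_val.
Qed.

(** At height [t] the density contributes [g1 t] and the curve [g2 t]. Writing the abscissa as
    [curve_fst a] turns the comparison with the curve into [t < a]: the sum is [1] below [a] and
    [curve_fst a * expR (t - 1)] above. For [a < y] the two ranges integrate to [a] and
    [a * expR (y - a) - a]. *)
Lemma runsort_permuton_corner (a y : R) : 0 <= a <= 1 -> 0 <= y <= 1 ->
  runsort_permuton (`[0, curve_fst a[ `*` `[0, y[)
  = (if y <= a then y else a * expR (y - a))%:E.
Proof.
move=> /andP[a0 a1] /andP[y0 y1].
set B := _ `*` _; have mB : measurable B by apply: measurableX.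
rewrite /runsort_permuton integral_mkcond [X in (_ + X)%E]integral_mkcond.
have mBC : measurable (B `&` curveC_plus).
  exact: measurableI mB (@measurable_curveC_plus R).
set f1 := _ \_ (B `&` curveC_plus).
have mf1 : measurable_fun setT f1.
  by apply/(measurable_restrictT _ mBC); exact: measurable_exp_snd.
have f1_ge0 z : (0 <= f1 z)%E.
  by rewrite /f1 patchE; case: ifP => // _; rewrite lee_fin expR_ge0.
rewrite fubini_tonelli2 //.
pose g1 t : \bar R := (expR (t - 1) * Num.min (curve_fst a) (curve_fst t))%:E.
have inner t : fubini_G mu f1 t = (g1 \_ `[0, y[) t.
  rewrite /fubini_G patchE; case: ifPn => [|ty]; last first.
    apply: integral0_eq => x _; rewrite /f1 patchE; case: ifPn => //.
    by rewrite inE => -[[_ yy] _]; move: ty; rewrite notin_setE.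
  rewrite inE /= in_itv /= => /andP[t0 ty].
  have t1 : t <= 1 by rewrite ltW // (lt_le_trans ty).
  rewrite /g1; set m := Num.min _ _.
  have m0 : 0 <= m by rewrite le_min !curve_fst_ge0.
  rewrite (_ : (fun x => f1 (x, t)) = (cst (expR (t - 1))%:E) \_ `[0%R, m[); last first.
    apply/funext => x; rewrite /f1 !patchE.
    congr (if _ then _ else _); apply/idP/idP; rewrite !inE /= !in_itv /=.
      move=> [[/= + _] [_ /= xh]]; rewrite in_itv /= => /andP[-> xa] /=.
      by rewrite lt_min xa.
    rewrite lt_min => /and3P[x0 xa xh]; split; split; rewrite /= ?in_itv /= ?x0 ?t0 //.
    split; rewrite /= in_itv /= ?t0 // x0 (le_trans (ltW xh)) //.
    by rewrite curve_fst_le1 // t0.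
  rewrite -integral_mkcond integral_cst//= lebesgue_measure_itv /= lte_fin.
  have -> : (if (0 < m)%R then m%:E - 0 else 0)%E = m%:E.
    by case: ltgtP m0 => // [_ _|<-]; rewrite ?sube0.
  by rewrite -EFinM.
set f2 := _ \_ [set y : R | _].
pose g2 t : \bar R := (if t < a then 1 - t else 0)%:E.
have inner2 t : f2 t = (g2 \_ `[0, y[) t.
  rewrite /f2 !patchE; case: ifPn => [|tC].
    rewrite inE /= => -[[/= + ty] _]; rewrite mem_setE ty in_itv /= => /andP[_ ta].
    move: ty; rewrite in_itv /= => /andP[t0 ty].
    rewrite /g2; case: ltP => // at_; move: ta; rewrite -/(curve_fst t) ltNge curve_fst_le //.
    by rewrite ltW // (lt_le_trans ty).
  case: ifPn => //; rewrite inE /= in_itv /= => /andP[t0 ty].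
  rewrite /g2; case: ltP => // ta; case/negP : tC; rewrite inE /=.
  have t1 : t <= 1 by rewrite ltW // (lt_le_trans ty).
  split; last by apply/curve_curveC; rewrite in_itv /= t0.
  by split; rewrite /= in_itv /= ?t0 // -/(curve_fst t) curve_fst_ge0 // curve_fst_lt.
have g1_ge0 t : 0 <= t -> (0 <= g1 t)%E.
  by move=> t0; rewrite lee_fin mulr_ge0 ?expR_ge0 // le_min !curve_fst_ge0.
have g2_ge0 t : t <= 1 -> (0 <= g2 t)%E.
  by move=> t1; rewrite lee_fin; case: ifP => // _; rewrite subr_ge0.
have mg1 : measurable_fun setT g1.
  apply/measurable_EFinP; apply: measurable_funM.
    by apply: measurableT_comp => //; exact: measurable_funB.
  by apply: measurable_minr => //; apply: continuous_measurable_fun; exact: continuous_curve_fst.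
have mg2 : measurable_fun setT g2.
  apply/measurable_EFinP; apply: measurable_fun_ifT => //.
    exact: measurable_fun_ltr.
  exact: measurable_funB.
transitivity (\int[mu]_(t in `[0%R, y[) (g1 t + g2 t))%E.
  rewrite [RHS]ge0_integralD //; last 4 first.
  - by move=> t; rewrite /= in_itv /= => /andP[t0 _]; exact: g1_ge0.
  - exact: measurable_funTS.
  - move=> t; rewrite /= in_itv /= => /andP[t0 ty]; apply: g2_ge0.
    by rewrite ltW // (lt_le_trans ty).
  - exact: measurable_funTS.
  rewrite [X in _ = (X + _)%E]integral_mkcond [X in _ = (_ + X)%E]integral_mkcond.
  by congr (_ + _)%E; apply: eq_integral => t _; [exact: inner | exact: inner2].
have early_one t : 0 <= t -> t < a ->
    (g1 t + g2 t = 1)%E.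
  move=> t0 ta; rewrite /g1 /g2 ta min_r ?curve_fst_le // ?ltW //.
  rewrite /curve_fst mulrCA -expRD addrA subrK subrr expR0 mulr1.
  by rewrite -EFinD addrC subrK.
case: leP => ya.
  transitivity (\int[mu]_(t in `[0%R, y[) (cst 1) t)%E.
    apply: eq_integral => t; rewrite inE /= in_itv /= => /andP[t0 ty].
    by rewrite early_one // (lt_le_trans ty).
  rewrite integral_cst //= mul1e lebesgue_measure_itv /= lte_fin.
  by case: ltgtP y0 => // [_ _|<-]; rewrite ?sube0.
have late t : a <= t -> t <= 1 -> (g1 t + g2 t = (curve_fst a * expR (t - 1))%:E)%E.
  move=> at_ t1; rewrite /g1 /g2 ltNge at_ /= adde0 min_l ?curve_fst_le //.
  by rewrite mulrC.
rewrite (_ : [set` `[0, y[] = [set` `[0, a[] `|` [set` `[a, y[]); last first.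
  by rewrite -itv_bndbnd_setU ?bnd_simp // ltW.
rewrite ge0_integral_setU //=; last 3 first.
- by apply: measurable_funTS; exact: emeasurable_funD.
- move=> t; rewrite !in_itv /= => ht; have /andP[t0 ty] : 0 <= t < y.
    by case: ht => /andP[h1 h2]; rewrite ?h2 ?(le_trans a0 h1) // h1 (lt_trans h2).
  by rewrite adde_ge0 ?g1_ge0 ?g2_ge0 // ltW // (lt_le_trans ty).
- apply/disj_set2P/seteqP; split => // t [] /=; rewrite !in_itv /= => /andP[_ ta] /andP[at_ _].
  by move: ta; rewrite ltNge at_.
have -> : (\int[mu]_(t in `[0%R, a[) (g1 t + g2 t) = a%:E)%E.
  transitivity (\int[mu]_(t in `[0%R, a[) (cst 1) t)%E.
    by apply: eq_integral => t; rewrite inE /= in_itv /= => /andP[t0 ta]; rewrite early_one.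
  rewrite integral_cst //= mul1e lebesgue_measure_itv /= lte_fin.
  by case: ltgtP a0 => // [_ _|<-]; rewrite ?sube0.
have -> : (\int[mu]_(t in `[a, y[) (g1 t + g2 t)
    = \int[mu]_(t in `[a, y[) (curve_fst a * expR (t - 1))%:E)%E.
  apply: eq_integral => t; rewrite inE /= in_itv /= => /andP[at_ ty].
  by rewrite late // ltW // (lt_le_trans ty).
have mul_expR t : curve_fst a * expR (t - 1) = a * expR (t - a).
  by rewrite /curve_fst -mulrA -expRD; congr (_ * expR _); ring.
rewrite integral_expR // -EFinD !mul_expR subrr expR0 mulr1; congr EFin.
by rewrite addrC subrK.
Qed.

End RunsortPermuton.

(** * Reduction of the rectangle distance to corners at the origin *)

Section Rectangles.
Variable R : realType.
Implicit Types (m : {measure set (R * R) -> \bar R}) (x y l u : R).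

Definition corner x y : set (R * R) := `[0, x[ `*` `[0, y[.

Lemma measurable_corner x y : measurable (corner x y).
Proof. exact: measurableX. Qed.

Lemma interval_endpoints (I : interval R) :
  [set` I] `<=` `[0, 1] -> [set` I] !=set0 ->
  exists l u, [/\ 0 <= l, l <= u, u <= 1,
    `]l, u[ `<=` [set` I] & [set` I] `<=` `[l, u]].
Proof.
move=> I01 [x0 Ix0]; have lbI : has_lbound [set` I].
  by exists 0 => x /I01; rewrite /= in_itv /= => /andP[].
have ubI : has_ubound [set` I].
  by exists 1 => x /I01; rewrite /= in_itv /= => /andP[].
have I0 : [set` I] !=set0 by exists x0.
exists (inf [set` I]), (sup [set` I]); split.
- by apply: lb_le_inf => // x /I01; rewrite /= in_itv /= => /andP[].
- by apply: le_trans (ge_inf lbI Ix0) _; exact: ub_le_sup.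
- by apply: ge_sup => // x /I01; rewrite /= in_itv /= => /andP[].
- move=> t; rewrite /= in_itv /= => /andP[It tI].
  have [s Is st] := inf_lt I0 It.
  have [s' Is' ts'] := sup_gt I0 tI.
  apply: (@interval_is_interval _ I _ _ Is Is').
  by rewrite !ltW.
- by move=> x Ix; rewrite /= in_itv /= ge_inf //= ub_le_sup.
Qed.

Section OneMeasure.
Variable m : {measure set (R * R) -> \bar R}.
Hypothesis m1 : m setT = 1%E.
Hypothesis vertical0 : forall x, m ([set x] `*` setT) = 0%E.
Hypothesis horizontal0 : forall y, m (setT `*` [set y]) = 0%E.

Lemma fin_num_measure1 B : measurable B -> m B \is a fin_num.
Proof.
move=> mB; rewrite ge0_fin_numE //; apply: (@le_lt_trans _ _ 1%E); last by rewrite ltry.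
by rewrite -m1; apply: le_measure; rewrite ?inE.
Qed.

Let half l u l' u' : set (R * R) := `[l, u[ `*` `[l', u'[.

Let mhalf l u l' u' : measurable (half l u l' u').
Proof. exact: measurableX. Qed.

Let line x y : set (R * R) := [set x] `*` setT `|` setT `*` [set y].

Let mline x y : measurable (line x y).
Proof. by apply: measurableU; apply: measurableX. Qed.

Let line0 x y : m (line x y) = 0%E.
Proof.
apply/eqP; rewrite -measure_le0; apply: le_trans (measureU2 _ _ _) _.
- exact: measurableX.
- exact: measurableX.
by rewrite [X in (X + _)%E]vertical0 [X in (_ + X)%E]horizontal0 adde0.
Qed.

Let le_up_to_line A B x y : measurable A -> measurable B ->
  A `<=` B `|` line x y -> (m A <= m B)%E.
Proof.
move=> mA mB AB; rewrite -[leRHS]adde0 -(line0 x y).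
apply: le_trans (measureU2 _ mB (mline x y)).
by apply: le_measure; rewrite ?inE //; exact: measurableU.
Qed.

(** The rectangle and its half-open version differ only on their sides, which lie on null lines: the
    upper sides matter for one inequality, the lower sides for the other. *)
Let measure_rectangle (I J : interval R) l u l' u' :
  `]l, u[ `<=` [set` I] -> [set` I] `<=` `[l, u] ->
  `]l', u'[ `<=` [set` J] -> [set` J] `<=` `[l', u'] ->
  m ([set` I] `*` [set` J]) = m (half l u l' u').
Proof.
move=> I1 I2 J1 J2; apply/eqP; rewrite eq_le; apply/andP; split.
  apply: (@le_up_to_line _ _ u u') => //; first exact: measurableX.
  move=> [x y] [/= /I2 + /J2]; rewrite /= !in_itv /= => /andP[lx xu] /andP[ly yu].
  have [->|xu'] := eqVneq x u; first by right; left.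
  have [->|yu'] := eqVneq y u'; first by right; right.
  by left; split; rewrite /= in_itv /= ?lx ?ly lt_neqAle ?xu' ?yu' ?xu ?yu.
apply: (@le_up_to_line _ _ l l') => //; first exact: measurableX.
move=> [x y] [xlu ylu].
have /andP[lx xu] : l <= x < u by move: xlu; rewrite /= in_itv.
have /andP[ly yu] : l' <= y < u' by move: ylu; rewrite /= in_itv.
have [->|xl] := eqVneq x l; first by right; left.
have [->|yl] := eqVneq y l'; first by right; right.
left; split; [apply: (I1 x) | apply: (J1 y)]; rewrite /= in_itv /= ?xu ?yu andbT.
  by rewrite lt_neqAle eq_sym xl.
by rewrite lt_neqAle eq_sym yl.
Qed.

Let measure_split_fst l u c d : 0 <= l -> l <= u ->
  fine (m (half 0 u c d)) = fine (m (half 0 l c d)) + fine (m (half l u c d)).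
Proof.
move=> l0 lu; rewrite -fineD ?fin_num_measure1 // -measureU //.
  congr (fine (m _)); apply/seteqP; split => [[x y]|[x y]].
    move=> [/=]; rewrite !in_itv /= => /andP[x0 xu] yy.
    by case: (ltP x l) => xl; [left|right]; split; rewrite /= in_itv /= ?x0 ?xl ?xu.
  move=> [|] [/=]; rewrite !in_itv /= => /andP[h1 h2] yy; split; rewrite /= in_itv //=.
    by rewrite h1 (lt_le_trans h2).
  by rewrite h2 (le_trans l0).
apply/seteqP; split => // -[x y] [[/= + _] [/= + _]]; rewrite !in_itv /=.
by move=> /andP[_ xl] /andP[lx _]; move: xl; rewrite ltNge lx.
Qed.

Let measure_split_snd c d l u : 0 <= l -> l <= u ->
  fine (m (half c d 0 u)) = fine (m (half c d 0 l)) + fine (m (half c d l u)).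
Proof.
move=> l0 lu; rewrite -fineD ?fin_num_measure1 // -measureU //.
  congr (fine (m _)); apply/seteqP; split => [[x y]|[x y]].
    move=> [/=] xx; rewrite !in_itv /= => /andP[y0 yu].
    by case: (ltP y l) => yl; [left|right]; split; rewrite /= ?in_itv /= ?y0 ?yl ?yu.
  move=> [|] [/=] xx; rewrite !in_itv /= => /andP[h1 h2]; split; rewrite /= ?in_itv //=.
    by rewrite h1 (lt_le_trans h2).
  by rewrite h2 (le_trans l0).
apply/seteqP; split => // -[x y] [[/= _ +] [/= _ +]]; rewrite !in_itv /=.
by move=> /andP[_ xl] /andP[lx _]; move: xl; rewrite ltNge lx.
Qed.

Lemma measure_rectangle_corners (I J : interval R) l u l' u' :
  0 <= l -> l <= u -> 0 <= l' -> l' <= u' ->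
  `]l, u[ `<=` [set` I] -> [set` I] `<=` `[l, u] ->
  `]l', u'[ `<=` [set` J] -> [set` J] `<=` `[l', u'] ->
  fine (m ([set` I] `*` [set` J])) = fine (m (corner u u')) -
    fine (m (corner l u')) - fine (m (corner u l')) + fine (m (corner l l')).
Proof.
move=> l0 lu l0' lu' I1 I2 J1 J2; rewrite (measure_rectangle I1 I2 J1 J2).
have := measure_split_fst 0 u' l0 lu; rewrite (measure_split_snd l u l0' lu').
have := measure_split_fst 0 l' l0 lu; rewrite /corner -/(half _ _ _ _).
rewrite /half; lra.
Qed.

End OneMeasure.

(** By inclusion-exclusion a rectangle is a signed sum of four corners, whence the factor [4]. *)
Lemma d_box_le_corners (m m' : {measure set (R * R) -> \bar R}) (e : R) : 0 <= e ->
  m setT = 1%E -> m' setT = 1%E ->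
  (forall x, m ([set x] `*` setT) = 0%E) -> (forall y, m (setT `*` [set y]) = 0%E) ->
  (forall x, m' ([set x] `*` setT) = 0%E) -> (forall y, m' (setT `*` [set y]) = 0%E) ->
  (forall x y, 0 <= x <= 1 -> 0 <= y <= 1 ->
    `|fine (m (corner x y)) - fine (m' (corner x y))| <= e) ->
  (d_box m m' <= (4 * e)%:E)%E.
Proof.
move=> e0 m1 m1' v h v' h' mm'; apply: ge_ereal_sup => _ [B [IJ [I [J EB]]] <-].
rewrite {}EB in IJ *.
(* A rectangle with an empty side has no endpoints to work with, but both of its masses vanish. *)
have [I0|I0] := eqVneq [set` I] set0.
  by rewrite I0 set0X !measure0 sube0 abse0 lee_fin mulr_ge0.
have [J0|J0] := eqVneq [set` J] set0.
  by rewrite J0 setX0 !measure0 sube0 abse0 lee_fin mulr_ge0.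
move/set0P : I0 => I0; move/set0P : J0 => J0.
have [|l [u [l0 lu u1 I1 I2]]] := interval_endpoints _ I0.
  by case: J0 => y Jy x Ix; have [] := IJ (x, y) (conj Ix Jy).
have [|l' [u' [l0' lu' u1' J1 J2]]] := interval_endpoints _ J0.
  by case: I0 => x Ix y Jy; have [] := IJ (x, y) (conj Ix Jy).
have mIJ : measurable ([set` I] `*` [set` J]) by exact: measurableX.
rewrite -(fineK (fin_num_measure1 m1 mIJ)) -(fineK (fin_num_measure1 m1' mIJ)).
rewrite -EFinB abse_EFin lee_fin.
rewrite (measure_rectangle_corners m1 v h l0 lu l0' lu' I1 I2 J1 J2).
rewrite (measure_rectangle_corners m1' v' h' l0 lu l0' lu' I1 I2 J1 J2).
have lu1 : 0 <= l <= 1 by rewrite l0 (le_trans lu).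
have uu1 : 0 <= u <= 1 by rewrite u1 (le_trans l0).
have lu1' : 0 <= l' <= 1 by rewrite l0' (le_trans lu').
have uu1' : 0 <= u' <= 1 by rewrite u1' (le_trans l0').
move: (mm' _ _ uu1 uu1') (mm' _ _ lu1 uu1') (mm' _ _ uu1 lu1') (mm' _ _ lu1 lu1').
rewrite !ler_norml; lra.
Qed.

End Rectangles.

(** * Comparison of the two distribution functions at every corner *)

Section CornerEstimates.
Variable R : realType.

Local Notation mu := (@lebesgue_measure R).

Definition runsort_cdf (x y : R) : R := Num.min (x * expR (y - 1)) y.

(** Since [y = curve_fst y * expR (y - 1)], comparing the two terms of the minimum amounts to
    comparing [curve_fst a] with [curve_fst y], that is, [a] with [y]. *)
Lemma runsort_cdf_curve_fst (a y : R) : 0 <= a <= 1 -> 0 <= y <= 1 ->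
  runsort_cdf (curve_fst a) y = if y <= a then y else a * expR (y - a).
Proof.
move=> /andP[a0 a1] /andP[y0 y1]; rewrite /runsort_cdf.
have E : y = curve_fst y * expR (y - 1).
  rewrite /curve_fst -mulrA -expRD (_ : 1 - y + _ = 0); last by ring.
  by rewrite expR0 mulr1.
case: leP => [ya|/ltW ay].
  by apply: min_r; rewrite {1}E ler_pM2r ?expR_gt0 // curve_fst_le.
rewrite min_l; last by rewrite [leRHS]E ler_pM2r ?expR_gt0 // curve_fst_le.
by rewrite /curve_fst -mulrA -expRD; congr (_ * expR _); ring.
Qed.

Lemma runsort_permuton_cdf (x y : R) : 0 <= x <= 1 -> 0 <= y <= 1 ->
  fine (runsort_permuton (corner x y)) = runsort_cdf x y.
Proof.
move=> /curve_fst_surj[a a01 <-] y01.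
by rewrite /corner runsort_permuton_corner // runsort_cdf_curve_fst.
Qed.

Lemma expR_sub_le (u v : R) : v <= u -> u <= 0 -> expR u - expR v <= u - v.
Proof.
move=> vu u0.
have h : 1 + (v - u) <= expR (v - u) by exact: expR_ge1Dx.
have e1 : expR u <= 1 by rewrite -[leRHS]expR0 ler_expR.
have -> : expR v = expR u * expR (v - u) by rewrite -expRD; congr expR; ring.
have e0 := expR_gt0 u; nra.
Qed.

(** Both terms of the minimum are 1-Lipschitz for the sum distance on the unit square. The bound is
    one-sided and is applied in both directions. *)
Lemma runsort_cdf_le (x y x' y' : R) :
  0 <= x <= 1 -> 0 <= y <= 1 -> 0 <= x' <= 1 -> 0 <= y' <= 1 ->
  runsort_cdf x y <= runsort_cdf x' y' + (`|x - x'| + `|y - y'|).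
Proof.
move=> /andP[x0 x1] /andP[y0 y1] /andP[x0' x1'] /andP[y0' y1'].
have hx := ler_norm (x - x'); have hy := ler_norm (y - y').
have nx := normr_ge0 (x - x'); have ny := normr_ge0 (y - y').
rewrite /runsort_cdf -lerBlDr le_min !lerBlDr !ge_min; apply/andP; split.
  apply/orP; left.
  have e1 : expR (y - 1) <= 1 by rewrite -[leRHS]expR0 ler_expR subr_le0.
  have e0 := expR_gt0 (y - 1).
  have e0' := expR_gt0 (y' - 1).
  have step1 : (x - x') * expR (y - 1) <= `|x - x'| by nra.
  have step2 : expR (y - 1) - expR (y' - 1) <= `|y - y'|.
    have [yy|yy] := leP y' y.
      by apply: le_trans (expR_sub_le _ _) _; rewrite ?subr_le0 //; lra.
    have : expR (y - 1) <= expR (y' - 1) by rewrite ler_expR lerD2r ltW.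
    lra.
  have step3 : x' * (expR (y - 1) - expR (y' - 1)) <= `|y - y'| by nra.
  lra.
by apply/orP; right; lra.
Qed.

Lemma curve_fst_dist (a a' : R) : 0 <= a' -> a' <= a -> a <= 1 ->
  `|curve_fst a - curve_fst a'| <= expR 1 * (a - a').
Proof.
move=> a0 aa a1; rewrite ger0_norm ?subr_ge0 ?curve_fst_le // /curve_fst.
have e1 : expR (1 - a) <= expR (1 - a') by rewrite ler_expR; lra.
have e2 : expR (1 - a') <= expR 1 by rewrite ler_expR; lra.
have e0 := expR_gt0 (1 - a).
nra.
Qed.

Section Perm.
Variables (n : nat) (p : 'S_n).
Hypothesis n_gt0 : (0 < n)%N.

Let fin_perm (B : set (R * R)) : measurable B -> perm_permuton p B \is a fin_num.
Proof. by move=> mB; apply: fin_num_measure1 => //; exact: perm_permuton_setT. Qed.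

Let mu_itv_le (x x' : R) : (mu `[x', x[ <= `|x - x'|%:E)%E.
Proof.
rewrite lebesgue_measure_itv /= lte_fin; case: ifP => // _.
by rewrite -EFinB lee_fin ler_norm.
Qed.

(** The first corner is covered by the second one, a vertical strip and a horizontal strip, and the
    strips are bounded through the marginals. *)
Lemma perm_permuton_corner_le (x y x' y' : R) :
  fine (perm_permuton p (corner x y))
  <= fine (perm_permuton p (corner x' y')) + (`|x - x'| + `|y - y'|).
Proof.
have mc := @measurable_corner R; have mx : measurable (`[x', x[ `*` [set: R]) by exact: measurableX.
have my : measurable ([set: R] `*` `[y', y[) by exact: measurableX.
rewrite -lee_fin EFinD fineK ?fin_perm // fineK ?fin_perm // EFinD.
apply: (@le_trans _ _ (perm_permuton p (corner x' y' `|`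
    (`[x', x[ `*` [set: R] `|` [set: R] `*` `[y', y[)))).
  apply: le_measure; rewrite ?inE //; first by apply: measurableU; [exact: mc | exact: measurableU].
  move=> [s t] [/=]; rewrite !in_itv /= => /andP[s0 sx] /andP[t0 ty].
  have [sx'|sx'] := ltP s x'; last by right; left; split; rewrite //= in_itv /= sx' sx.
  have [ty'|ty'] := ltP t y'; last by right; right; split; rewrite //= in_itv /= ty' ty.
  by left; split; rewrite /= in_itv /= ?s0 ?sx' ?t0 ?ty'.
apply: (le_trans (@measureU2 _ _ _ (perm_permuton p) _ _ (mc _ _) (measurableU _ _ mx my))).
apply: leeD => //; apply: (le_trans (@measureU2 _ _ _ (perm_permuton p) _ _ mx my)).
apply: leeD; apply: le_trans (mu_itv_le _ _).
  exact: perm_permuton_vertical.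
exact: perm_permuton_horizontal.
Qed.

Lemma perm_permuton_line0 (x : R) :
  perm_permuton p ([set x] `*` setT) = 0%E /\ perm_permuton p (setT `*` [set x]) = 0%E.
Proof.
split; apply/eqP; rewrite -measure_le0 -(lebesgue_measure_set1 x).
  exact: perm_permuton_vertical.
exact: perm_permuton_horizontal.
Qed.

End Perm.

Definition early_mass n (p : 'S_n) (A B : nat) : R :=
  (count (fun u => (u < B)%N) (early A (one_line p)))%:R / n%:R.

(** With threshold [n] the early mass counts all early entries, so it is the rescaled position at
    which the prefix from [perm_early] ends. *)
Lemma perm_permuton_early n (p : 'S_n) A B : (0 < n)%N ->
  fine (perm_permuton (runsort p) (corner (early_mass p A n) (B%:R / n%:R)))
  = early_mass p A B.
Proof.
move=> n0; have -> : early_mass p A n = (size (early A (one_line p)))%:R / n%:R.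
  congr (_%:R / _); apply/eqP; rewrite -all_count; apply/allP => u.
  rewrite -(perm_mem (perm_early A (one_line p))) => /mem_take.
  by rewrite (perm_mem (perm_runsort_iota p)) mem_iota.
rewrite /corner perm_permuton_corner // runsortE /early_mass.
by rewrite (seq.permP (perm_early A (one_line p))).
Qed.

Lemma grid_dist (n M i : nat) : (0 < n)%N -> (0 < M)%N ->
  `|i%:R / M%:R - (n * i %/ M)%:R / n%:R| <= n%:R^-1 :> R.
Proof.
move=> n0 M0; have n0R : 0 < n%:R :> R by rewrite ltr0n.
have M0R : 0 < M%:R :> R by rewrite ltr0n.
have E : n%:R * i%:R = (n * i %/ M)%:R * M%:R + (n * i %% M)%:R :> R.
  by rewrite -!natrM -natrD -divn_eq.
have -> : i%:R / M%:R - (n * i %/ M)%:R / n%:R = (n * i %% M)%:R / (n%:R * M%:R) :> R.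
  rewrite (_ : i%:R = ((n * i %/ M)%:R * M%:R + (n * i %% M)%:R) / n%:R); last first.
    by rewrite -E mulrAC divff ?mul1r // gt_eqF.
  by field; rewrite !gt_eqF.
rewrite ger0_norm ?divr_ge0 ?mulr_ge0 // invfM mulrCA -[leRHS]mulr1 ler_pM2l ?invr_gt0 //.
by rewrite ler_pdivrMr // mul1r ler_nat ltnW // ltn_mod.
Qed.

Lemma cvg_grid (M i : nat) : (0 < M)%N ->
  (fun n => (n * i %/ M)%N%:R / n%:R) @ \oo --> (i%:R / M%:R : R).
Proof.
move=> M0; apply/cvgrPdist_le => e e0; near=> n.
have n0 : 0 < n%:R :> R by near: n; exact: nbhs_infty_gtr.
apply: le_trans (grid_dist _ _ M0) _; first by rewrite -(ltr_nat R).
rewrite invf_ple ?posrE //; apply: ltW; near: n; exact: nbhs_infty_gtr.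
Unshelve. all: by end_near. Qed.

Lemma early_mass_grid (M i j : nat) : (0 < M)%N -> (i <= M)%N -> (j <= M)%N ->
  cvg_in_prob (fun n (p : 'S_n) => early_mass p (n * i %/ M) (n * j %/ M))
    (runsort_cdf (curve_fst (i%:R / M%:R)) (j%:R / M%:R) : R).
Proof.
move=> M0 iM jM; have M0R : 0 < M%:R :> R by rewrite ltr0n.
have grid01 k : (k <= M)%N -> 0 <= (k%:R / M%:R : R) <= 1.
  by move=> kM; rewrite divr_ge0 //= ler_pdivrMr // mul1r ler_nat.
have grid_le k n : (k <= M)%N -> (n * k %/ M <= n)%N.
  by move=> kM; rewrite -[leqRHS](mulnK n M0) leq_div2r // leq_mul2l kM orbT.
rewrite runsort_cdf_curve_fst ?grid01 // ler_pM2r ?invr_gt0 // ler_nat.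
case: leqP => [ji|ij].
  apply: cvg_in_prob_early_ge => [n||n]; [exact: grid_le|exact: cvg_grid|].
  by rewrite leq_div2r // leq_mul2l ji orbT.
apply: cvg_in_prob_early_le => [n|||n]; [exact: grid_le|exact: cvg_grid|exact: cvg_grid|].
by rewrite leq_div2r // leq_mul2l ltnW // orbT.
Qed.

(* The corner [(x, y)] is compared with [(s, B / n)], where [s] is the rescaled
   number of entries whose run starts below [A]: there the mass of the runsorted
   permutation is exactly [early_mass p A B]. *)
Lemma corner_close n (p : 'S_n) (M : nat) (d x y : R) : (0 < n)%N -> (0 < M)%N ->
  n%:R^-1 <= d -> (expR 1 + 1) / M%:R <= d ->
  (forall i j, (i <= M)%N -> (j <= M)%N ->
    `|early_mass p (n * i %/ M) (n * j %/ M)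
      - runsort_cdf (curve_fst (i%:R / M%:R)) (j%:R / M%:R)| <= d) ->
  0 <= x <= 1 -> 0 <= y <= 1 ->
  `|fine (perm_permuton (runsort p) (corner x y))
    - fine (runsort_permuton (corner x y))| <= 5 * d.
Proof.
move=> n0 M0 nd Md good x01 y01; have M0R : 0 < M%:R :> R by rewrite ltr0n.
have grid (z : R) : 0 <= z <= 1 -> exists i : nat,
    [/\ (i <= M)%N, i%:R / M%:R <= z & z - i%:R / M%:R <= M%:R^-1].
  move=> /andP[z0 z1]; have zM0 : 0 <= z * M%:R by rewrite mulr_ge0.
  have /andP[h1 h2] := truncn_itv zM0.
  exists (Num.trunc (z * M%:R)); split.
  - by rewrite -(ler_nat R) (le_trans h1) // ler_piMl.
  - by rewrite ler_pdivrMr.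
  - rewrite lerBlDr addrC.
    apply: le_trans (_ : _ <= (Num.trunc (z * M%:R)).+1%:R / M%:R) _.
      by rewrite ler_pdivlMr // ltW.
    by rewrite -natr1 mulrDl mul1r.
have [a a01 ax] := curve_fst_surj x01.
have [i [iM ia ai]] := grid a a01; have [j [jM jy yj]] := grid y y01.
have i01 : 0 <= (i%:R / M%:R : R) <= 1.
  by rewrite divr_ge0 //= (le_trans ia) //; case/andP: a01.
have j01 : 0 <= (j%:R / M%:R : R) <= 1.
  by rewrite divr_ge0 //= (le_trans jy) //; case/andP: y01.
rewrite runsort_permuton_cdf //.
pose g (x y : R) := fine (perm_permuton (runsort p) (corner x y)).
pose xi : R := curve_fst (i%:R / M%:R); pose yj' : R := j%:R / M%:R.
rewrite -/yj' in jy yj j01.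
have xi01 : 0 <= xi <= 1.
  by rewrite curve_fst_ge0 ?curve_fst_le1 //; case/andP: i01.
pose s := early_mass p (n * i %/ M) n.
pose B := (n * j %/ M)%N.
have sxi : `|s - xi| <= d.
  (* Taking [j = M] controls the position [s] itself, because the limiting distribution function at
     height [1] is [curve_fst]; for [i = M] its other branch gives the same value [1]. *)
  have := good i M iM (leqnn M); rewrite mulnK // divff ?gt_eqF //.
  rewrite runsort_cdf_curve_fst // ?ler01 ?lexx //.
  case: (leP 1 (i%:R / M%:R)) => [i1|_]; last by rewrite /xi /curve_fst.
  have E : i%:R / M%:R = 1 :> R by apply/eqP; rewrite eq_le i1; case/andP: i01 => _ ->.
  by rewrite /xi E curve_fst1.
have xxi : `|x - xi| <= expR 1 * M%:R^-1.
  rewrite -ax; apply: le_trans (curve_fst_dist _ ia _) _.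
  - by case/andP: i01.
  - by case/andP: a01.
  - by rewrite ler_pM2l // expR_gt0.
have yB : `|yj' - B%:R / n%:R| <= n%:R^-1 by exact: grid_dist.
have yyj : `|y - yj'| <= M%:R^-1 by rewrite ger0_norm // subr_ge0.
have gs : g s (B%:R / n%:R) = early_mass p (n * i %/ M) B by exact: perm_permuton_early.
have e1 : `|g s (B%:R / n%:R) - runsort_cdf xi yj'| <= d by rewrite gs; exact: good.
have e2 : g x y <= g s (B%:R / n%:R) + (`|x - s| + `|y - B%:R / n%:R|).
  exact: perm_permuton_corner_le.
have e3 : g s (B%:R / n%:R) <= g x y + (`|s - x| + `|B%:R / n%:R - y|).
  exact: perm_permuton_corner_le.
have e4 := runsort_cdf_le x01 y01 xi01 j01.
have e5 := runsort_cdf_le xi01 j01 x01 y01.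
have t1 : `|x - s| <= `|x - xi| + `|xi - s| by exact: ler_distD.
have t2 : `|y - B%:R / n%:R| <= `|y - yj'| + `|yj' - B%:R / n%:R| by exact: ler_distD.
rewrite mulrDl mul1r in Md.
rewrite (distrC s x) (distrC (B%:R / n%:R)) in e3.
rewrite (distrC xi x) (distrC yj') in e5.
rewrite (distrC xi s) in t1.
rewrite -[fine _]/(g x y).
move: e1; rewrite !ler_norml => /andP[e1 e1'].
(* Moving the permutation corner costs at most [3 * d], namely [(expR 1 + 1) / M], [|xi - s|] and
   [1 / n]; the estimate at the grid point and moving the limit back cost [d] each. *)
by apply/andP; split; lra.
Qed.

End CornerEstimates.

(** * Conclusion by a union bound over a finite grid *)

Theorem mainTheorem1 (R : realType) (eps : R) (eps_gt0 : 0 < eps) :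
  (fun n : nat =>
     uniform_pr R [set p : 'S_n |
       (d_box (perm_permuton (runsort p)) runsort_permuton < eps%:E)%E]%SET)
    @ \oo --> (1 : R).
Proof.
(* Each corner costs [5 * d] and a rectangle has four, so the distance is at most
   [20 * d = eps / 2]. *)
pose d := eps / 40; have d0 : 0 < d by exact: divr_gt0.
have [M [M0 Md]] : exists M : nat, (0 < M)%N /\ (expR 1 + 1) / M%:R <= d.
  near \oo => M; exists M.
  have M0 : 0 < M%:R :> R by near: M; exact: nbhs_infty_gtr.
  split; first by rewrite -(ltr_nat R).
  rewrite ler_pdivrMr // mulrC -ler_pdivrMr //.
  by apply: ltW; near: M; exact: nbhs_infty_gtr.
(* [M] is fixed before [n], so only finitely many grid points have to be good at once. *)
have := whp_all (enum {: 'I_M.+1 * 'I_M.+1}) (fun ij : 'I_M.+1 * 'I_M.+1 =>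
  @early_mass_grid R M _ _ M0 (ltn_ord ij.1) (ltn_ord ij.2) _ d0).
apply: whp_near; near=> n => p /allP good.
have n0 : (0 < n)%N by near: n; exact: nbhs_infty_gt.
have nd : n%:R^-1 <= d.
  rewrite invf_ple ?posrE ?ltr0n //.
  by apply: ltW; near: n; exact: nbhs_infty_gtr.
apply: (@le_lt_trans _ _ (4 * (5 * d))%:E); last first.
  by rewrite lte_fin /d; lra.
have line0 := @perm_permuton_line0 R n (runsort p) n0.
apply: d_box_le_corners.
- by rewrite mulr_ge0 // ltW.
- exact: perm_permuton_setT.
- exact: probability_setT.
- by move=> x; have [] := line0 x.
- by move=> x; have [] := line0 x.
- exact: runsort_permuton_vertical.
- exact: runsort_permuton_horizontal.
move=> x y; apply: (corner_close n0 M0 nd Md) => i j iM jM.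
by apply: (good (Ordinal (iM : (i < M.+1)%N), Ordinal (jM : (j < M.+1)%N))); rewrite mem_enum.
Unshelve. all: by end_near. Qed.
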